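(* Let $m$ be the Lebesgue measure on $\mathbb{C}$ and let $\pi_m$ be the Poisson measure on the configuration space $\Gamma(\mathbb{C})$ with intensity measure $m$. Then for every natural number $p\geq 2$, for $\pi_m$-almost all $\gamma\in\Gamma(\mathbb{C})$, the product $$\Pi_p(z,\gamma)=\prod_{x\in\gamma,\; x\neq 0} E_p\!\left(\frac{z}{x}\right)$$ is well defined (convergent) for all $z\in\mathbb{C}$, and $z\mapsto \Pi_p(z,\gamma)$ is an entire function on $\mathbb{C}$.
   Context: For $p\in\mathbb{N}=\{1,2,\dots\}$ the elementary factor $E_p$ is $E_p(z)=(1-z)\exp\{z+\frac{z^2}{2}+\dots+\frac{z^p}{p}\}$, $z\in\mathbb{C}$. $\Gamma(\mathbb{C})$ denotes the space of all locally finite subsets $\gamma\subset\mathbb{C}$ (called configurations), i.e. subsets having finitely many points in every compact set. For $f\in C_0(\mathbb{C})$ (continuous with compact support) put $\langle f,\gamma\rangle=\sum_{x\in\gamma}f(x)$; $\Gamma(\mathbb{C})$ carries the usual $\sigma$-algebra generated by the maps $\gamma\mapsto\langle f,\gamma\rangle$, $f\in C_0(\mathbb{C})$. The Lebesgue measure is $m(dz)=dx\,dy$, $z=x+iy$. The Poisson measure $\pi_m$ with intensity $m$ is the probability measure on $\Gamma(\mathbb{C})$ defined via the Laplace transform $$\int_{\Gamma(\mathbb{C})} e^{\langle f,\gamma\rangle}\,d\pi_m(\gamma)=\exp\left(\int_{\mathbb{C}}\left(e^{f(x)}-1\right)dm(x)\right),\qquad f\in C_0(\mathbb{C}).$$ The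 product over the (countable, unordered) set $\{x\in\gamma: x\neq 0\}$ is understood as an infinite product over that set whose convergence and value do not depend on an enumeration of it. *)

(* Defs.v *)
From HB Require Import structures.
From mathcomp Require Import all_boot all_order all_algebra.
From mathcomp Require Import complex.
From mathcomp Require Import all_classical all_reals all_analysis.

Set Implicit Arguments.
Unset Strict Implicit.
Unset Printing Implicit Defensive.

Import Order.TTheory GRing.Theory Num.Theory.
Import numFieldNormedType.Exports.

Local Open Scope classical_set_scope.
Local Open Scope ring_scope.
Local Open Scope complex_scope.

(* R[i] carries no topology in the library. This is the one of the modulus,
   as a normed module over itself, so that [derivable f z 1] is complex
   differentiability of f at z. *)
HB.instance Definition _ (R : realType) := NormedModule.copy R[i] R[i]^o.

Section Plane.
Variable R : realType.

Definition borelC := g_sigma_algebraType (@open R[i]).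

Definition plane (w : R * R) : borelC := w.1 +i* w.2.

Lemma plane_near (w : R * R) (U : set R[i]) : open U -> U (plane w) ->
  exists2 r : R, 0 < r & forall v : R * R,
    `|w.1 - v.1| < r -> `|w.2 - v.2| < r -> U (plane v).
Proof.
rewrite openE => oU /oU; rewrite /interior => /nbhs_ballP[/= e e0 eU].
move: e e0 eU => [a b]; rewrite ltcE /= => /andP[/eqP -> a0] eU.
exists (a / 2) => [|v v1 v2]; first by rewrite divr_gt0.
apply: eU; rewrite /ball /= normc_def /= ltcR.
rewrite (le_lt_trans (y := `|w.1 - v.1| + `|w.2 - v.2|)) //.
  rewrite -[leRHS]ger0_norm ?addr_ge0// -sqrtr_sqr ler_wsqrtr//.
  rewrite [leRHS]sqrrD !real_normK ?num_real// addrAC lerDl.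
  by rewrite mulrn_wge0// mulr_ge0.
by rewrite (splitr a) ltrD.
Qed.

Lemma measurable_plane : measurable_fun [set: R * R] plane.
Proof.
apply: (@measurability _ _ _ borelC _ _ (@open R[i])) => // _ [U oU <-]; rewrite setTI.
pose box (i : (rat * rat) * (rat * rat)) : set (R * R) :=
  `]ratr i.1.1, ratr i.1.2[%classic `*` `]ratr i.2.1, ratr i.2.2[%classic.
pose boxU i := if `[< box i `<=` plane @^-1` U >] then box i else set0.
rewrite (_ : _ @^-1` U = \bigcup_i boxU i); last first.
  apply/seteqP; split => [w Uw|w [i _]]; last first.
    by rewrite /boxU; case: asboolP => // h; exact: h.
  have [r r0 rU] := plane_near oU Uw.
  have lo (x : R) : x - r < x by rewrite ltrBlDr ltrDl.
  have hi (x : R) : x < x + r by rewrite ltrDl.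
  have [a] := rat_in_itvoo (lo w.1); rewrite in_itv/= => /andP[a1 a2].
  have [b] := rat_in_itvoo (hi w.1); rewrite in_itv/= => /andP[b1 b2].
  have [c] := rat_in_itvoo (lo w.2); rewrite in_itv/= => /andP[c1 c2].
  have [d] := rat_in_itvoo (hi w.2); rewrite in_itv/= => /andP[d1 d2].
  exists ((a, b), (c, d)) => //; rewrite /boxU; case: asboolP => [_|[]].
    by split; rewrite /= in_itv/= ?a2 ?b1 ?c2 ?d1.
  move=> v [] /=; rewrite !in_itv/= => /andP[va vb] /andP[vc vd].
  apply: rU; rewrite distrC ltr_distl.
    by rewrite (lt_trans a1 va) (lt_trans vb b2).
  by rewrite (lt_trans c1 vc) (lt_trans vd d2).
apply: countable_bigcupT_measurable => // i; rewrite /boxU.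
by case: asboolP => // _; apply: measurableX; exact: measurable_itv.
Qed.

Definition lebesgueC : set borelC -> \bar R :=
  pushforward (lebesgue_measure \x lebesgue_measure)%E plane.

HB.instance Definition _ := Measure.copy lebesgueC
  (measure_function_pushforward__canonical__measure_function_Measure
     (lebesgue_measure \x lebesgue_measure)%E measurable_plane).

End Plane.
Arguments lebesgueC : clear implicits.

Section Configurations.
Variable R : realType.

Definition locally_finite : set (set R[i]) :=
  [set A | forall K : set R[i], compact K -> finite_set (K `&` A)].

Lemma locally_finite0 : set0 \in locally_finite.
Proof. by rewrite inE => K _; rewrite setI0; exact: finite_set0. Qed.

Definition configuration := {A : set R[i] | A \in locally_finite}.
HB.instance Definition _ := Choice.on configuration.
HB.instance Definition _ :=
  isPointed.Build configuration (exist _ set0 locally_finite0).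

Definition points (gamma : configuration) : set R[i] := sval gamma.

Definition C0 : set (R[i] -> R) :=
  [set f | continuous f /\ compact (closure [set z | f z != 0])].

(* For f in C0 the sum has finite support, so that \sum_(_ \in _) is the
   actual sum and not its junk value 0. *)
Definition pairing (f : R[i] -> R) (gamma : configuration) : R :=
  \sum_(x \in points gamma) f x.

Definition pairing_cylinders : set (set configuration) :=
  \bigcup_(f in C0) preimage_set_system [set: configuration] (pairing f)
    (@measurable _ (measurableTypeR R)).

Definition Gamma := g_sigma_algebraType pairing_cylinders.

Definition is_poisson_measure (mu : {measure set (borelC R) -> \bar R})
    (P : probability Gamma R) : Prop :=
  forall f : R[i] -> R, C0 f ->
  (\int[P]_gamma (expR (pairing f gamma))%:E =
   expeR (\int[mu]_x (expR (f x) - 1)%:E))%E.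

End Configurations.

Section InfiniteProducts.
Variable R : realType.
Implicit Types (u : nat -> R[i]) (l : R[i]).

(* Convergence of an infinite product in the classical sense: up to finitely
   many factors, which may vanish, the partial products tend to a nonzero
   limit. *)
Definition infinite_prod u l : Prop :=
  exists (N : nat) (q : R[i]), [/\ q != 0,
    \prod_(N <= k < n) u k @[n --> \oo] --> q &
    l = (\prod_(k < N) u k) * q].

(* [None] pads the sequence, so that finite and infinite sets are both
   enumerated by sequences. *)
Definition enumerates (T : Type) (e : nat -> option T) (S : set T) : Prop :=
  (forall x, S x <-> exists n, e n = Some x) /\
  (forall m n x, e m = Some x -> e n = Some x -> m = n).

Definition has_unordered_prod (T : Type) (S : set T) (a : T -> R[i]) l : Prop :=
  countable S /\
  forall e, enumerates e S -> infinite_prod (fun n => oapp a 1 (e n)) l.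

Definition unordered_prod_converges (T : Type) (S : set T) (a : T -> R[i]) :=
  exists l, has_unordered_prod S a l.

(* Only meaningful when the product converges; the value is then unique. *)
Definition unordered_prod (T : Type) (S : set T) (a : T -> R[i]) : R[i] :=
  get [set l | has_unordered_prod S a l].

End InfiniteProducts.

Section WeierstrassProduct.
Variable R : realType.

Definition expC (z : R[i]) : R[i] :=
  (expR (complex.Re z))%:C * (cos (complex.Im z) +i* sin (complex.Im z)).

Definition elementary_factor (p : nat) (z : R[i]) : R[i] :=
  (1 - z) * expC (\sum_(1 <= k < p.+1) z ^+ k / k%:R).

Definition Pi_factor (p : nat) (z x : R[i]) : R[i] := elementary_factor p (z / x).

Definition Pi_converges (p : nat) (z : R[i]) (gamma : Gamma R) : Prop :=
  unordered_prod_converges (points gamma `\ 0) (Pi_factor p z).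

Definition Pi (p : nat) (z : R[i]) (gamma : Gamma R) : R[i] :=
  unordered_prod (points gamma `\ 0) (Pi_factor p z).

Definition entire (F : R[i] -> R[i]) : Prop := forall z, derivable F z 1.

End WeierstrassProduct.

(* Main.v *)
(** Almost every configuration [gamma] satisfies [sum |x| ^ -3 < oo] over its
    nonzero points.  Indeed [|x| ^ -3] is dominated by the increasing limit of the
    functions [bump n = sum_(k < n) 8 ^ -k tent_k] of class [C0], where [tent_k]
    is 1 on the disc of radius [2 ^ k] and 0 off the disc of radius [2 ^ k.+1].
    Their integrals are bounded uniformly in [n], hence so are, by the Laplace
    transform, the exponential moments of the pairings [<bump n, gamma>], and
    monotone convergence makes the supremum of these pairings almost surely finite.

    For such [gamma], put [s = 1 / x].  Since [d/dz E_p(z s)] equals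
    [- s ^ p.+1 z ^ p exp(q(z s))] with [q(w) = sum_(1 <= k <= p) w ^ k / k],
    near any [z] the factor is [A + h B + h ^ 2 c(h)] with
    [|A - 1| + |B| + |c(h)| = O(|x| ^ -3)].  The l1 norm of such expansions is
    submultiplicative, so the partial products have uniformly bounded second-order
    remainders, and their pointwise limit is complex differentiable.  This replaces
    Cauchy's theory. *)
Require Import Defs.
From mathcomp Require Import all_boot all_order all_algebra.
From mathcomp Require Import complex.
From mathcomp Require Import all_classical all_reals all_analysis.
From mathcomp Require Import measurable_realfun ring lra.

Set Implicit Arguments.
Unset Strict Implicit.
Unset Printing Implicit Defensive.

Import Order.TTheory GRing.Theory Num.Theory.
Import numFieldNormedType.Exports.

Local Open Scope classical_set_scope.
Local Open Scope ring_scope.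
Local Open Scope complex_scope.

(** * Real-valued modulus, complex limits and differentiability *)

Section Modulus.
Variable R : realType.
Implicit Types z w : R[i].

(** The norm of [R[i]] takes its values in [R[i]] itself; a modulus with values in [R] opens the
    estimates to [lra] and to suprema of reals. *)
Definition cnorm z : R := Num.sqrt (complex.Re z ^+ 2 + complex.Im z ^+ 2).

Lemma normC_cnorm z : `|z| = (cnorm z)%:C.
Proof. exact: normc_def. Qed.

Lemma cnorm_ge0 z : 0 <= cnorm z.
Proof. exact: sqrtr_ge0. Qed.

Lemma cnorm0 : cnorm 0 = 0.
Proof. by apply: complexI; rewrite -normC_cnorm normr0. Qed.

Lemma cnorm1 : cnorm 1 = 1.
Proof. by apply: complexI; rewrite -normC_cnorm normr1. Qed.

Lemma cnormM z w : cnorm (z * w) = cnorm z * cnorm w.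
Proof. by apply: complexI; rewrite rmorphM/= -!normC_cnorm normrM. Qed.

Lemma cnormX z n : cnorm (z ^+ n) = cnorm z ^+ n.
Proof. by apply: complexI; rewrite rmorphXn/= -!normC_cnorm normrX. Qed.

Lemma cnormV z : cnorm z^-1 = (cnorm z)^-1.
Proof. by apply: complexI; rewrite fmorphV/= -!normC_cnorm normfV. Qed.

Lemma cnormN z : cnorm (- z) = cnorm z.
Proof. by apply: complexI; rewrite -!normC_cnorm normrN. Qed.

Lemma cnormB z w : cnorm (z - w) = cnorm (w - z).
Proof. by rewrite -cnormN opprB. Qed.

Lemma cnorm_eq0 z : (cnorm z == 0) = (z == 0).
Proof. by rewrite -[RHS]normr_eq0 normC_cnorm (inj_eq (@complexI R) _ 0). Qed.

Lemma cnorm_real (x : R) : cnorm x%:C = `|x|.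
Proof. by rewrite /cnorm /= expr0n addr0 sqrtr_sqr. Qed.

Lemma ler_cnormD z w : cnorm (z + w) <= cnorm z + cnorm w.
Proof. by rewrite -lecR rmorphD/= -!normC_cnorm ler_normD. Qed.

Lemma ler_cnorm_sub z w v : cnorm (z - w) <= cnorm (z - v) + cnorm (v - w).
Proof. by rewrite (le_trans _ (ler_cnormD _ _))// addrA subrK. Qed.

Lemma cnorm_le_normC z (r : R) : (`|z| <= r%:C) = (cnorm z <= r).
Proof. by rewrite normC_cnorm lecR. Qed.

Lemma Re_le_cnorm z : `|complex.Re z| <= cnorm z.
Proof. by rewrite -sqrtr_sqr ler_wsqrtr// lerDl sqr_ge0. Qed.

Lemma Im_le_cnorm z : `|complex.Im z| <= cnorm z.
Proof. by rewrite -sqrtr_sqr ler_wsqrtr// lerDr sqr_ge0. Qed.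

Lemma cnorm_le_ReIm z : cnorm z <= `|complex.Re z| + `|complex.Im z|.
Proof.
rewrite -[leRHS]ger0_norm ?addr_ge0// -sqrtr_sqr ler_wsqrtr//.
by rewrite [leRHS]sqrrD !real_normK ?num_real// addrAC lerDl mulrn_wge0 ?mulr_ge0.
Qed.

Lemma gt0_complexE (e : R[i]) : 0 < e -> exists2 r : R, 0 < r & e = r%:C.
Proof.
by move: e => [a b]; rewrite ltcE /= => /andP[/eqP -> a0]; exists a.
Qed.

Lemma cvgCP (T : Type) (F : set_system T) (FF : Filter F) (f : T -> R[i]) (l : R[i]) :
  f x @[x --> F] --> l <->
  forall e : R, 0 < e -> \forall x \near F, cnorm (l - f x) <= e.
Proof.
split=> [/cvgrPdist_le fl e e0|fl].
  move: (fl e%:C); rewrite ltcR => /(_ e0); apply: filterS => x.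
  by rewrite cnorm_le_normC.
apply/cvgrPdist_le => _ /gt0_complexE[e e0 ->].
by apply: filterS (fl _ e0) => x; rewrite cnorm_le_normC.
Qed.

Lemma cvgnCP (u : nat -> R[i]) (l : R[i]) :
  u n @[n --> \oo] --> l <->
  forall e : R, 0 < e -> exists N, forall n, (N <= n)%N -> cnorm (l - u n) <= e.
Proof.
split=> [/cvgCP ul e e0|ul].
  by have [N _ NP] := ul _ e0; exists N => n Nn; exact: NP.
by apply/cvgCP => e /ul[N NP]; exists N.
Qed.

(** Real and imaginary parts are 1-Lipschitz for [cnorm], so completeness of [R] suffices. *)
Lemma cauchyC (u : nat -> R[i]) :
  (forall e : R, 0 < e ->
    exists N, forall n, (N <= n)%N -> cnorm (u n - u N) <= e) ->
  exists l : R[i], u n @[n --> \oo] --> l.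
Proof.
move=> cu.
have cvgR (f : R[i] -> R) :
    (forall z w, `|f z - f w| <= cnorm (z - w)) -> cvgn (f \o u).
  move=> fL; apply: cauchy_cvg; apply/cauchy_exP => e e0.
  have [N NP] := cu _ (divr_gt0 e0 (ltr0n _ 2)).
  exists (f (u N)); exists N => // n /= Nn; rewrite /ball /=.
  rewrite distrC (le_lt_trans (fL _ _))// (le_lt_trans (NP _ Nn))//; lra.
have ReL z w : `|complex.Re z - complex.Re w| <= cnorm (z - w).
  by rewrite -raddfB Re_le_cnorm.
have ImL z w : `|complex.Im z - complex.Im w| <= cnorm (z - w).
  by rewrite -raddfB Im_le_cnorm.
have /cvg_ex[/= a /cvgrPdist_le ua] := cvgR _ ReL.
have /cvg_ex[/= b /cvgrPdist_le ub] := cvgR _ ImL.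
exists (a +i* b); apply/cvgCP => e e0.
have e20 : 0 < e / 2 by lra.
have uae := ua _ e20; have ube := ub _ e20.
near=> n; apply: (le_trans (cnorm_le_ReIm _)).
have : `|a - complex.Re (u n)| <= e / 2 by near: n.
have : `|b - complex.Im (u n)| <= e / 2 by near: n.
rewrite !raddfB/=; lra.
Unshelve. all: by end_near. Qed.

End Modulus.

(** The difference quotient is within C |h| of [D]. The field is left general because the lemma
    serves both real paths, in [mean_value], and complex limits, in [jet_lim_derivable]. *)
Lemma quadratic_is_derive (K : numFieldType) (F : K -> K) (z D C : K) :
  (forall h, `|h| <= 1 -> `|F (z + h) - F z - h * D| <= C * `|h| ^+ 2) ->
  is_derive z 1 F D.
Proof.
move=> FD; have C0 : 0 <= C.
  by have := FD 1; rewrite normr1 expr1n mulr1 => /(_ (lexx _)); apply: le_trans.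
have FD' : h^-1 *: (F (h *: 1 + z) - F z) @[h --> 0^'] --> D.
  apply/cvgrPdist_le => e e0.
  have C10 : 0 < C + 1 by rewrite ltr_wpDl.
  have e'0 : 0 < e / (C + 1) by rewrite divr_gt0.
  have B1 : \forall h \near (0 : K), `|h| <= 1.
    by apply/nbhs_normP; exists 1 => //= h; rewrite /= sub0r normrN => /ltW.
  have B2 : \forall h \near (0 : K), `|h| <= e / (C + 1).
    by apply/nbhs_normP; exists (e / (C + 1)) => //= h; rewrite /= sub0r normrN => /ltW.
  rewrite !near_withinE; near=> h => h0.
  have h1 : `|h| <= 1 by near: h.
  have he : `|h| <= e / (C + 1) by near: h.
  have hn : 0 < `|h| by rewrite normr_gt0.
  rewrite -(ler_pM2l hn) -normrM.
  have -> : h * (D - h^-1 *: (F (h *: 1 + z) - F z)) = - (F (z + h) - F z - h * D).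
    rewrite mulrBr [h *: 1]mulr1 (addrC h) [h^-1 *: _]mulrC mulrCA divff// mulr1.
    by rewrite [RHS]opprB.
  rewrite normrN (le_trans (FD _ h1))// expr2 mulrA (mulrC _ `|h|) ler_wpM2l//.
  move: he; rewrite ler_pdivlMr// mulrC; apply: le_trans.
  by rewrite ler_wpM2r// lerDl.
by apply: DeriveDef; [apply/cvg_ex; exists D|exact/cvg_lim].
Unshelve. all: by end_near. Qed.

(** * Second-order expansions, their products and their limits *)

Section Jets.
Variable R : realType.
Implicit Types (F G : R[i] -> R[i]) (z h A B : R[i]) (M N : R).

(* Over the unit disc around z, F is an affine function of h plus h ^ 2 c(h).
   The bound M controls the l1 norm of the coefficients, which is
   submultiplicative for products of such expansions. *)
Definition jet F z M A B := forall h, cnorm h <= 1 ->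
  exists2 c, F (z + h) = A + h * B + h ^+ 2 * c & cnorm A + cnorm B + cnorm c <= M.

Lemma jet_value F z M A B : jet F z M A B -> A = F z.
Proof.
move=> /(_ 0); rewrite cnorm0 => /(_ ler01)[c + _].
by rewrite addr0 mul0r expr0n mul0r !addr0.
Qed.

Lemma jet1 z : jet (fun=> 1) z 1 1 0.
Proof. by move=> h _; exists 0; rewrite ?mulr0 ?addr0// cnorm0 cnorm1 !addr0. Qed.

Lemma jetM F G z M N A B A' B' : jet F z M A B -> jet G z N A' B' ->
  jet (fun w => F w * G w) z (M * N) (A * A') (A * B' + B * A').
Proof.
move=> FJ GJ h h1; have [c Fc Mc] := FJ h h1; have [c' Gc Nc] := GJ h h1.
(* All terms of degree at least 2 in [h], divided by h^2. Since |h| <= 1, the leftover powers of [h]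
   do not increase the modulus. *)
exists (A * c' + B * B' + c * A' + h * (B * c' + c * B') + h ^+ 2 * (c * c')).
  by rewrite Fc Gc; ring.
have := ler_pM (addr_ge0 (addr_ge0 (cnorm_ge0 A) (cnorm_ge0 B)) (cnorm_ge0 c))
  (addr_ge0 (addr_ge0 (cnorm_ge0 A') (cnorm_ge0 B')) (cnorm_ge0 c')) Mc Nc.
apply: le_trans.
have h2 : cnorm (h ^+ 2) <= 1 by rewrite cnormX exprn_ile1 ?cnorm_ge0.
have D1 := ler_cnormD (A * B') (B * A').
have D2 := ler_cnormD (B * c') (c * B').
have D3 := ler_cnormD (A * c') (B * B').
have D4 := ler_cnormD (A * c' + B * B') (c * A').
have D5 := ler_cnormD (A * c' + B * B' + c * A') (h * (B * c' + c * B')).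
have D6 := ler_cnormD (A * c' + B * B' + c * A' + h * (B * c' + c * B'))
  (h ^+ 2 * (c * c')).
have H1 : cnorm (h * (B * c' + c * B')) <= cnorm (B * c' + c * B').
  by rewrite cnormM ler_piMl// cnorm_ge0.
have H2 : cnorm (h ^+ 2 * (c * c')) <= cnorm (c * c').
  by rewrite cnormM ler_piMl// cnorm_ge0.
rewrite !cnormM in D1 D2 D3 D4 D5 D6 H1 H2 *; lra.
Qed.

Lemma jet_prod (F : nat -> R[i] -> R[i]) z (M : nat -> R) :
  (forall n, exists A B, jet (F n) z (M n) A B) ->
  forall n, exists A B, jet (fun w => \prod_(k < n) F k w) z (\prod_(k < n) M k) A B.
Proof.
move=> FJ; elim=> [|n [A [B AB]]].
  exists 1, 0; rewrite big_ord0 (_ : (fun w => _) = fun=> 1); first exact: jet1.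
  by apply/funext => w; rewrite big_ord0.
have [A' [B' AB']] := FJ n; exists (A * A'), (A * B' + B * A').
rewrite big_ord_recr/= (_ : (fun w => _) = fun w => (\prod_(k < n) F k w) * F n w).
  exact: jetM.
by apply/funext => w; rewrite big_ord_recr.
Qed.

(** The uniform remainder bound turns convergence of the values into convergence of the linear
    coefficients; it then passes to the limit itself and yields the derivative. *)
Lemma jet_lim_derivable (P : nat -> R[i] -> R[i]) (Q : R[i] -> R[i]) z M :
  (forall n, exists A B, jet (P n) z M A B) ->
  (forall w, P n w @[n --> \oo] --> Q w) -> derivable Q z 1.
Proof.
move=> PJ PQ.
have {PJ} [B PB] : exists B : nat -> R[i], forall n, jet (P n) z M (P n z) (B n).
  suff : forall n, exists Bn, jet (P n) z M (P n z) Bn by move=> /choice[B ?]; exists B.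
  by move=> n; have [A [B AB]] := PJ n; exists B; rewrite -(jet_value AB).
have M0 : 0 <= M.
  have [|c _] := PB 0 0; first by rewrite cnorm0.
  by apply: le_trans; rewrite !addr_ge0 ?cnorm_ge0.
have {PB} PB n h : cnorm h <= 1 ->
    cnorm (P n (z + h) - P n z - h * B n) <= M * cnorm h ^+ 2.
  move=> h1; have [c -> cM] := PB n h h1.
  rewrite [X in cnorm X](_ : _ = h ^+ 2 * c); last by ring.
  rewrite cnormM cnormX mulrC ler_wpM2r ?exprn_ge0 ?cnorm_ge0//.
  by apply: le_trans cM; rewrite lerDr addr_ge0 ?cnorm_ge0.
have PC w e : 0 < e -> exists N : nat, forall n m, (N <= n)%N -> (N <= m)%N ->
    cnorm (P n w - P m w) <= e.
  move=> e0; have [|N NP] := (cvgnCP _ _).1 (PQ w) (e / 2); first lra.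
  exists N => n m /NP Nn /NP Nm; have := ler_cnorm_sub (P n w) (P m w) (Q w).
  rewrite (cnormB (P n w) (Q w)); lra.
have [b Bb] : exists l : R[i], B n @[n --> \oo] --> l.
  (* Once the values at [z] and [z + t] vary by at most t^2, comparing two expansions at [h = t]
     gives t |B n - B m| <= 2 M t^2 + 2 t^2. The choice of [t] makes 2 (M + 1) t at most [e] and
     keeps [t] in the unit disc. *)
  apply: cauchyC => e e0; pose t := Num.min 1 (e / (2 * (M + 1))).
  have t0 : 0 < t.
    by rewrite lt_min ltr01 divr_gt0// mulr_gt0// ltr_wpDl.
  have t1 : t <= 1 by rewrite ge_min lexx.
  have te : t * (2 * (M + 1)) <= e.
    by rewrite -ler_pdivlMr ?ge_min ?lexx ?orbT// mulr_gt0// ltr_wpDl.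
  have [|N1 N1P] := PC z (t ^+ 2); first exact: exprn_gt0.
  have [|N2 N2P] := PC (z + t%:C) (t ^+ 2); first exact: exprn_gt0.
  exists (maxn N1 N2) => n Nn.
  have tn : cnorm t%:C = t by rewrite cnorm_real gtr0_norm.
  have := PB n t%:C; have := PB (maxn N1 N2) t%:C; rewrite tn => /(_ t1) + /(_ t1).
  have := N1P n (maxn N1 N2) (leq_trans (leq_maxl _ _) Nn) (leq_maxl _ _).
  have := N2P n (maxn N1 N2) (leq_trans (leq_maxr _ _) Nn) (leq_maxr _ _).
  set m := maxn _ _ => H1 H2 H3 H4.
  suff : t * cnorm (B n - B m) <= t * (t * (2 * (M + 1))).
    by rewrite ler_pM2l// => /le_trans; exact.
  rewrite -[X in X * cnorm _]tn -cnormM.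
  rewrite [X in cnorm X](_ : _ = (P m (z + t%:C) - P m z - t%:C * B m)
    - (P n (z + t%:C) - P n z - t%:C * B n)
    + (P n (z + t%:C) - P m (z + t%:C)) - (P n z - P m z)); last by ring.
  apply: le_trans (ler_cnormD _ _) _; rewrite cnormN.
  apply: le_trans (lerD (ler_cnormD _ _) (lexx _)) _.
  apply: le_trans (lerD (lerD (ler_cnormD _ _) (lexx _)) (lexx _)) _.
  rewrite cnormN; move: H1 H2 H3 H4; rewrite expr2; lra.
apply: (@ex_derive _ _ _ _ _ _ b).
apply: (@quadratic_is_derive _ _ _ _ M%:C) => h.
rewrite !normC_cnorm -(rmorph1 (real_complex R)) lecR => h1.
rewrite -rmorphXn -rmorphM lecR.
apply/ler_addgt0Pl => e e0.
have e3 : 0 < e / 3 by lra.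
have [N1 N1P] := (cvgnCP _ _).1 (PQ z) _ e3.
have [N2 N2P] := (cvgnCP _ _).1 (PQ (z + h)) _ e3.
have [N3 N3P] := (cvgnCP _ _).1 Bb _ e3.
pose n := maxn N1 (maxn N2 N3).
have := N1P n (leq_maxl _ _).
have := N2P n (leq_trans (leq_maxl _ _) (leq_maxr _ _)).
have := N3P n (leq_trans (leq_maxr _ _) (leq_maxr _ _)).
have := PB n h h1 => H1 H2 H3 H4.
rewrite [X in cnorm X](_ : _ = (P n (z + h) - P n z - h * B n)
    + (Q (z + h) - P n (z + h)) - (Q z - P n z) - h * (b - B n)); last by ring.
have H5 : cnorm (h * (b - B n)) <= e / 3.
  by rewrite cnormM (le_trans _ H2)// ler_piMl// cnorm_ge0.
apply: le_trans (ler_cnormD _ _) _; rewrite cnormN.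
apply: le_trans (lerD (ler_cnormD _ _) (lexx _)) _; rewrite cnormN.
apply: le_trans (lerD (lerD (ler_cnormD _ _) (lexx _)) (lexx _)) _.
lra.
Qed.

End Jets.

(** The mean value theorem on the segment between 0 and [x]. As [df] is bounded only for |t| <= |x|,
    [M] may depend on [x], which gives the quadratic estimates below. *)
Lemma norm_le_of_derive (R : realType) (f df : R -> R) (x M : R) :
  (forall t : R, is_derive t 1 f (df t)) -> (forall t, `|t| <= `|x| -> `|df t| <= M) ->
  `|f x - f 0| <= M * `|x|.
Proof.
move=> fd dfM.
have cf (a b : R) : {within `[a, b], continuous f}.
  apply: continuous_subspaceT => t; apply: differentiable_continuous.
  exact/derivable1_diffP/ex_derive.
have [x0|x0|->] := ltgtP x 0; last by rewrite subrr !normr0 mulr0.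
- have [c] := MVT x0 (fun t _ => fd t) (cf x 0).
  rewrite in_itv/= => /andP[xc c0] fc; rewrite -opprB fc sub0r mulrN opprK normrM.
  by rewrite ler_wpM2r// dfM// ltr0_norm// ltr0_norm//; lra.
- have [c] := MVT x0 (fun t _ => fd t) (cf 0 x).
  rewrite in_itv/= => /andP[c0 cx] ->; rewrite subr0 normrM.
  by rewrite ler_wpM2r// dfM// gtr0_norm// gtr0_norm//; lra.
Qed.

(** * First- and second-order estimates for the real exponential, sine and cosine *)

Section RealExponential.
Variable R : realType.
Implicit Types x r : R.

Lemma expR_sub1_le x r : `|x| <= r -> `|expR x - 1| <= expR r * `|x|.
Proof.
move=> xr; rewrite -[X in _ - X]expR0; apply: norm_le_of_derive => t tx.
by rewrite ger0_norm ?expR_ge0// ler_expR (le_trans (ler_norm t))// (le_trans tx).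
Qed.

Lemma expR_sub1D_le x r : `|x| <= r -> `|expR x - 1 - x| <= expR r * `|x| ^+ 2.
Proof.
move=> xr; have := @norm_le_of_derive _ (fun t => expR t - t) (fun t => expR t - 1)
  x (expR r * `|x|) _ _; rewrite expR0 subr0 [_ - x - 1]addrAC expr2 mulrA; apply.
move=> t tx; rewrite (le_trans (expR_sub1_le (le_trans tx xr)))//.
by rewrite ler_wpM2l ?expR_ge0.
Qed.

Lemma sin_le x : `|sin x| <= `|x|.
Proof.
have := @norm_le_of_derive _ (@sin R) (@cos R) x 1 _ _.
by rewrite sin0 subr0 mul1r; apply => t _; rewrite ler_norml cos_geN1 cos_le1.
Qed.

(** The bound on the sine is left open: 1 gives a linear estimate, |x| a quadratic one. *)
Lemma cos_sub1_le x M : (forall t, `|t| <= `|x| -> `|sin t| <= M) ->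
  `|cos x - 1| <= M * `|x|.
Proof.
move=> sM; rewrite -[X in _ - X]cos0.
by apply: (@norm_le_of_derive _ _ (fun t => - sin t)) => t tx; rewrite normrN sM.
Qed.

Lemma sin_subx_le x : `|sin x - x| <= `|x| ^+ 2.
Proof.
have := @norm_le_of_derive _ (fun t => sin t - t) (fun t => cos t - 1) x `|x| _ _.
rewrite sin0 !subr0 -expr2; apply => t tx.
apply: le_trans tx; rewrite -[leRHS]mul1r; apply: cos_sub1_le => u _.
by rewrite ler_norml sin_geN1 sin_le1.
Qed.

End RealExponential.

(** * Calculus of quadratic remainders and the complex exponential *)

Section EntireFunctions.
Variable R : realType.
Implicit Types (F G f g : R[i] -> R[i]) (z w h A B : R[i]) (r M : R).

(* Asking for a quadratic remainder on discs of every radius makes the notion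
   stable under composition with expC without shrinking neighbourhoods. *)
Definition qderiv F z A := forall r, exists2 C, 0 <= C &
  forall h, cnorm h <= r -> cnorm (F (z + h) - F z - h * A) <= C * cnorm h ^+ 2.

Lemma qderiv_cst z w : qderiv (fun=> w) z 0.
Proof. by move=> r; exists 0 => // h _; rewrite subrr mulr0 subr0 cnorm0 mul0r. Qed.

Lemma qderiv_id z : qderiv id z 1.
Proof.
move=> r; exists 0 => // h _.
by rewrite [X in cnorm X](_ : _ = 0) ?cnorm0 ?mul0r//; ring.
Qed.

Lemma qderivD F G z A B : qderiv F z A -> qderiv G z B ->
  qderiv (fun w => F w + G w) z (A + B).
Proof.
move=> FA GB r; have [C C0 FC] := FA r; have [C' C'0 GC] := GB r.
exists (C + C') => [|h hr]; first exact: addr_ge0.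
rewrite [X in cnorm X](_ : _ = (F (z + h) - F z - h * A) +
  (G (z + h) - G z - h * B)); last by ring.
by rewrite mulrDl (le_trans (ler_cnormD _ _))// lerD ?FC ?GC.
Qed.

Lemma qderivM F G z A B : qderiv F z A -> qderiv G z B ->
  qderiv (fun w => F w * G w) z (A * G z + F z * B).
Proof.
move=> FA GB r; have [C C0 FC] := FA r; have [C' C'0 GC] := GB r.
pose r' := `|r|.
(* Read off from the splitting of the remainder as [rF * G (z + h) + (F z + h * A) * rG + h ^+ 2 *
   (A * B)]. Using |r| for [r] keeps the constant nonnegative. *)
exists (C * (cnorm (G z) + r' * cnorm B + C' * r' ^+ 2) +
  (cnorm (F z) + r' * cnorm A) * C' + cnorm A * cnorm B) => [|h hr].
  by rewrite !(addr_ge0, mulr_ge0) ?exprn_ge0 ?cnorm_ge0 ?normr_ge0.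
have hr' : cnorm h <= r' by rewrite (le_trans hr)// ler_norm.
set rF := F (z + h) - F z - h * A.
set rG := G (z + h) - G z - h * B.
have rFC : cnorm rF <= C * cnorm h ^+ 2 by exact: FC.
have rGC : cnorm rG <= C' * cnorm h ^+ 2 by exact: GC.
have GzE : G (z + h) = G z + h * B + rG by rewrite /rG; ring.
have FzE : F (z + h) = F z + h * A + rF by rewrite /rF; ring.
rewrite [X in cnorm X](_ : _ = rF * G (z + h) + (F z + h * A) * rG +
  h ^+ 2 * (A * B)); last by rewrite FzE GzE; ring.
have G1 : cnorm (G (z + h)) <= cnorm (G z) + r' * cnorm B + C' * r' ^+ 2.
  rewrite GzE (le_trans (ler_cnormD _ _))// lerD//.
    by rewrite (le_trans (ler_cnormD _ _))// lerD// cnormM ler_wpM2r ?cnorm_ge0.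
  by rewrite (le_trans rGC)// ler_wpM2l// lerXn2r// nnegrE ?cnorm_ge0 ?normr_ge0.
have F1 : cnorm (F z + h * A) <= cnorm (F z) + r' * cnorm A.
  by rewrite (le_trans (ler_cnormD _ _))// lerD// cnormM ler_wpM2r ?cnorm_ge0.
have T1 := ler_pM (cnorm_ge0 _) (cnorm_ge0 _) rFC G1.
have T2 := ler_pM (cnorm_ge0 _) (cnorm_ge0 _) F1 rGC.
apply: le_trans (ler_cnormD _ _) _.
apply: le_trans (lerD (ler_cnormD _ _) (lexx _)) _.
rewrite !cnormM; apply: le_trans (lerD (lerD T1 T2) (lexx _)) _.
by rewrite le_eqVlt; apply/orP; left; apply/eqP; ring.
Qed.

Lemma qderivX z n : qderiv (fun w => w ^+ n) z (n%:R * z ^+ n.-1).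
Proof.
elim: n => [|n IH]; first by rewrite mul0r; exact: qderiv_cst.
have -> : n.+1%:R * z ^+ n = 1 * z ^+ n + z * (n%:R * z ^+ n.-1).
  case: n {IH} => [|n]; first by rewrite expr0; ring.
  by rewrite exprS /= -[n.+2]addn1 natrD; ring.
have -> : (fun w => w ^+ n.+1) = fun w => w * w ^+ n.
  by apply/funext => w; rewrite exprS.
exact: (qderivM (qderiv_id z) IH).
Qed.

Lemma qderiv_sum (F : nat -> R[i] -> R[i]) (A : nat -> R[i]) z (s : seq nat) :
  (forall n, qderiv (F n) z (A n)) ->
  qderiv (fun w => \sum_(k <- s) F k w) z (\sum_(k <- s) A k).
Proof.
move=> FA; elim: s => [|k s IH].
  rewrite big_nil (_ : (fun w => _) = fun=> 0); first exact: qderiv_cst.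
  by apply/funext => w; rewrite big_nil.
rewrite big_cons (_ : (fun w => _) = fun w => F k w + \sum_(k <- s) F k w).
  exact: qderivD.
by apply/funext => w; rewrite big_cons.
Qed.

Lemma qderivZ F z A B : qderiv F z A -> qderiv (fun w => B * F w) z (B * A).
Proof.
by move=> /(qderivM (qderiv_cst z B)); rewrite mul0r add0r.
Qed.

(* The real mean value theorem, applied to the component of F along the
   direction of the difference to be bounded. *)
Lemma mean_value F f z h A M : (forall w, qderiv F w (f w)) ->
  (forall t : R, 0 <= t <= 1 -> cnorm (f (z + t%:C * h) - A) <= M) ->
  cnorm (F (z + h) - F z - h * A) <= M * cnorm h.
Proof.
move=> Ff fM; set v := F (z + h) - F z - h * A.
(* Thanks to the conjugate, [phi] goes from 0 at t = 0 to |v|^2 at t = 1. *)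
pose phi (t : R) := complex.Re (v^* * (F (z + t%:C * h) - F z - t%:C * h * A)).
pose dphi t := complex.Re (v^* * (h * (f (z + t%:C * h) - A))).
have normJ w : cnorm w^* = cnorm w by rewrite /cnorm; case: w => a b /=; rewrite sqrrN.
have phiE (t : R) : is_derive t 1 phi (dphi t).
  have [C C0 FC] := Ff (z + t%:C * h) (cnorm h).
  apply: (@quadratic_is_derive _ _ _ _ (cnorm v * (C * cnorm h ^+ 2))) => s s1.
  have sRe w : s * complex.Re w = complex.Re (s%:C * w).
    by case: w => a b /=; rewrite mul0r subr0.
  rewrite /phi /dphi sRe -!raddfB (le_trans (Re_le_cnorm _))//.
  rewrite [X in cnorm X](_ : _ = v^* * (F (z + t%:C * h + s%:C * h) -
    F (z + t%:C * h) - s%:C * h * f (z + t%:C * h))); last first.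
    by rewrite [(t + s)%:C]rmorphD -(addrA z) -mulrDl; ring.
  rewrite cnormM normJ -[leRHS]mulrA ler_wpM2l ?cnorm_ge0//.
  rewrite (le_trans (FC _ _)) ?cnormM ?cnorm_real//.
    by rewrite ler_piMl ?cnorm_ge0.
  by rewrite exprMn mulrA mulrAC.
have [] := @MVT _ phi dphi 0 1 ltr01 (fun t _ => phiE t) _.
  apply: continuous_subspaceT => t; apply: differentiable_continuous.
  exact/derivable1_diffP/ex_derive.
move=> t; rewrite in_itv/= => /andP[t0 t1]; rewrite subr0 mulr1.
have -> : phi 0 = 0 by rewrite /phi mul0r addr0 subrr mul0r subr0 mulr0.
have -> : phi 1 = cnorm v ^+ 2.
  rewrite /phi mul1r -/v sqr_sqrtr ?addr_ge0 ?sqr_ge0//.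
  by case: (v) => a b /=; ring.
rewrite subr0 => vE.
have : cnorm v ^+ 2 <= cnorm v * (M * cnorm h).
  rewrite vE (le_trans (ler_norm _))// (le_trans (Re_le_cnorm _))// !cnormM normJ.
  rewrite ler_wpM2l ?cnorm_ge0// mulrC ler_wpM2r ?cnorm_ge0// fM// (ltW t0) ltW//.
(* Division by |v| fails when v = 0; the claim is then [0 <= M * cnorm h], and [M] is nonnegative by
   the hypothesis at t = 0. *)
have := cnorm_ge0 v; rewrite le_eqVlt => /predU1P[<- _|v0].
  by rewrite mulr_ge0 ?cnorm_ge0 ?(le_trans (cnorm_ge0 _) (fM 0 _))// lexx ler01.
by rewrite expr2 ler_pM2l.
Qed.

Lemma expCD z w : expC (z + w) = expC z * expC w.
Proof.
case: z w => [a b] [c d]; rewrite /expC /= expRD cosD sinD.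
by apply/eqP; rewrite eq_complex /=; apply/andP; split; apply/eqP; ring.
Qed.

Lemma expC0 : expC 0 = 1 :> R[i].
Proof. by rewrite /expC /= expR0 cos0 sin0 mul1r. Qed.

Lemma cnorm_expC z : cnorm (expC z) = expR (complex.Re z).
Proof.
rewrite /expC cnormM cnorm_real ger0_norm ?expR_ge0//.
by rewrite /cnorm /= cos2Dsin2 sqrtr1 mulr1.
Qed.

Lemma cnorm_expC_le z r : cnorm z <= r -> cnorm (expC z) <= expR r.
Proof.
move=> zr; rewrite cnorm_expC ler_expR (le_trans (ler_norm _))//.
by rewrite (le_trans (Re_le_cnorm _)).
Qed.

(** The expansion at 0 is enough: the functional equation transports it to every other point. *)
Lemma qderiv_expC0 : qderiv (@expC R) 0 1.
Proof.
(* The real and the imaginary part each contribute 2 exp(r) |h|^2. *)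
move=> r; exists (4 * expR r) => [|[a b] hr]; first by rewrite mulr_ge0 ?expR_ge0.
rewrite add0r mulr1 expC0.
have ah := Re_le_cnorm (a +i* b); have bh := Im_le_cnorm (a +i* b).
move: ah bh hr => /=; set H := cnorm (a +i* b) => ah bh hr.
apply: le_trans (cnorm_le_ReIm _) _ => /=; rewrite !(mul0r, addr0, subr0).
have H0 : 0 <= H by exact: cnorm_ge0.
have E1 : 1 <= expR r by rewrite -expR0 ler_expR; lra.
have ar := le_trans ah hr; have br := le_trans bh hr.
have e1 := expR_sub1_le ar; have e2 := expR_sub1D_le ar.
have ea : expR a <= expR r by rewrite ler_expR (le_trans (ler_norm _)).
have c1 : `|cos b - 1| <= `|b| ^+ 2.
  by apply: cos_sub1_le => t tb; exact: le_trans (sin_le t) tb.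
have s1 := sin_subx_le b.
have a2 : `|a| ^+ 2 <= H ^+ 2 by rewrite lerXn2r// nnegrE.
have b2 : `|b| ^+ 2 <= H ^+ 2 by rewrite lerXn2r// nnegrE.
have ab : `|a| * `|b| <= H ^+ 2 by rewrite expr2 ler_pM.
have Re1 : `|expR a * cos b - 1 - a| <= expR r * H ^+ 2 + expR r * H ^+ 2.
  rewrite (_ : _ - a = (expR a - 1 - a) + expR a * (cos b - 1)); last by ring.
  rewrite (le_trans (ler_normD _ _))// lerD//.
    by rewrite (le_trans e2)// ler_wpM2l ?expR_ge0.
  by rewrite normrM ger0_norm ?expR_ge0// ler_pM ?expR_ge0 ?(le_trans c1).
have Im1 : `|expR a * sin b - b| <= expR r * H ^+ 2 + expR r * H ^+ 2.
  rewrite (_ : _ - b = expR a * (sin b - b) + (expR a - 1) * b); last by ring.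
  rewrite (le_trans (ler_normD _ _))// lerD//.
    by rewrite normrM ger0_norm ?expR_ge0// ler_pM ?expR_ge0 ?(le_trans s1).
  rewrite normrM (le_trans (ler_wpM2r (normr_ge0 _) e1))// -mulrA.
  by rewrite ler_wpM2l ?expR_ge0.
rewrite (le_trans (lerD Re1 Im1))//; lra.
Qed.

Lemma qderiv_expC_comp F z A : qderiv F z A ->
  qderiv (fun w => expC (F w)) z (A * expC (F z)).
Proof.
move=> FA r; have [C C0 FC] := FA r; pose r' := `|r|.
have r'0 : 0 <= r' by exact: normr_ge0.
(* A Lipschitz constant of [F] at [z] for increments |h| <= r', so that the increment of [F] stays
   in the disc of radius [L * r'], on which exp is expanded. *)
pose L := cnorm A + C * r'.
have L0 : 0 <= L by rewrite addr_ge0 ?cnorm_ge0 ?mulr_ge0.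
have [C' C'0 EC] := qderiv_expC0 (L * r').
exists (cnorm (expC (F z)) * (C' * L ^+ 2 + C)) => [|h hr].
  by rewrite !(mulr_ge0, addr_ge0) ?cnorm_ge0 ?exprn_ge0.
have hr' : cnorm h <= r' by rewrite (le_trans hr)// ler_norm.
pose d := F (z + h) - F z.
have dC : cnorm (d - h * A) <= C * cnorm h ^+ 2 by exact: FC.
have dL : cnorm d <= L * cnorm h.
  rewrite -[d](subrK (h * A)) (le_trans (ler_cnormD _ _))//.
  rewrite (le_trans (lerD dC (lexx _)))// cnormM /L mulrDl addrC mulrC lerD//.
  by rewrite -mulrA ler_wpM2l// expr2 ler_wpM2r ?cnorm_ge0.
have dr : cnorm d <= L * r' by rewrite (le_trans dL)// ler_wpM2l.
rewrite (_ : F (z + h) = F z + d); last by rewrite /d; ring.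
rewrite expCD [X in cnorm X](_ : _ = expC (F z) * ((expC (0 + d) - expC 0 - d * 1)
  + (d - h * A))); last by rewrite expC0 add0r; ring.
rewrite cnormM -[leRHS]mulrA ler_wpM2l ?cnorm_ge0// (le_trans (ler_cnormD _ _))//.
rewrite [leRHS]mulrDl lerD// (le_trans (EC _ dr))// -[leRHS]mulrA ler_wpM2l// -exprMn.
by rewrite lerXn2r// ?nnegrE ?cnorm_ge0// mulr_ge0 ?cnorm_ge0.
Qed.

End EntireFunctions.

(** * Bounds and Lipschitz constants uniform in a parameter *)

Section ElementaryFactor.
Variable R : realType.
Implicit Types (z w s h : R[i]) (r M : R).

(** [mean_value] with [A = 0]: the disc is convex, so exp is bounded by exp(r) on the whole segment
    from [w] to [z]. *)
Lemma expC_lipschitz z w r : cnorm z <= r -> cnorm w <= r ->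
  cnorm (expC z - expC w) <= expR r * cnorm (z - w).
Proof.
move=> zr wr.
have dE v : qderiv (@expC R) v (expC v).
  by rewrite -[X in qderiv _ _ X]mul1r; exact: (qderiv_expC_comp (qderiv_id v)).
have := @mean_value _ (@expC R) (@expC R) w (z - w) 0 (expR r) dE.
rewrite (addrC w) subrK mulr0 subr0; apply => t /andP[t0 t1].
rewrite subr0; apply: cnorm_expC_le.
rewrite (_ : _ + _ = (1 - t)%:C * w + t%:C * z); last first.
  by rewrite rmorphB rmorph1; ring.
rewrite (le_trans (ler_cnormD _ _))// !cnormM !cnorm_real !ger0_norm ?subr_ge0//.
rewrite (_ : r = (1 - t) * r + t * r); last by ring.
by rewrite lerD// ler_wpM2l// subr_ge0.
Qed.

(* The Taylor expansions in z have to be uniform in the parameter s = 1 / x. *)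
Definition bounded_lipschitz (g : R[i] -> R[i] -> R[i]) (r1 r2 : R) :=
  exists2 M, 0 <= M & forall s z w, cnorm s <= r1 -> cnorm z <= r2 -> cnorm w <= r2 ->
    cnorm (g s z) <= M /\ cnorm (g s z - g s w) <= M * cnorm (z - w).

Variables r1 r2 : R.
Local Notation BL g := (bounded_lipschitz g r1 r2).

Lemma bounded_lipschitz_cst w : BL (fun _ _ => w).
Proof.
exists (cnorm w) => [|s z z' _ _ _]; first exact: cnorm_ge0.
by rewrite subrr cnorm0 mulr_ge0 ?cnorm_ge0.
Qed.

Lemma bounded_lipschitz_param : BL (fun s _ => s).
Proof.
exists `|r1| => // s z z' sr _ _.
by rewrite subrr cnorm0 mulr_ge0 ?cnorm_ge0 ?(le_trans sr) ?ler_norm.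
Qed.

Lemma bounded_lipschitz_id : BL (fun _ z => z).
Proof.
(* The added 1 makes the same constant a Lipschitz constant of the identity. *)
exists (`|r2| + 1) => [|s z w _ zr _]; first by rewrite addr_ge0.
split; first by rewrite (le_trans zr)// (le_trans (ler_norm _))// lerDl.
by rewrite ler_peMl ?cnorm_ge0// lerDr.
Qed.

Lemma bounded_lipschitzD f g : BL f -> BL g -> BL (fun s z => f s z + g s z).
Proof.
move=> [M M0 fM] [N N0 gN]; exists (M + N) => [|s z w sr zr wr]; first exact: addr_ge0.
have [f1 f2] := fM s z w sr zr wr; have [g1 g2] := gN s z w sr zr wr.
rewrite opprD addrACA mulrDl.
by split; rewrite (le_trans (ler_cnormD _ _))// lerD.
Qed.

Lemma bounded_lipschitzM f g : BL f -> BL g -> BL (fun s z => f s z * g s z).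
Proof.
move=> [M M0 fM] [N N0 gN]; exists (2 * (M * N)) => [|s z w sr zr wr].
  by rewrite !mulr_ge0.
have [f1 f2] := fM s z w sr zr wr; have [g1 g2] := gN s z w sr zr wr.
have [f1' _] := fM s w z sr wr zr; have MN : 0 <= M * N by exact: mulr_ge0.
split; first by rewrite cnormM (le_trans (ler_pM _ _ f1 g1)) ?cnorm_ge0//; lra.
rewrite [X in cnorm X](_ : _ = (f s z - f s w) * g s z + f s w * (g s z - g s w));
  last by ring.
rewrite (le_trans (ler_cnormD _ _))// !cnormM.
have h1 := ler_pM (cnorm_ge0 _) (cnorm_ge0 _) f2 g1.
have h2 := ler_pM (cnorm_ge0 _) (cnorm_ge0 _) f1' g2.
by apply: le_trans (lerD h1 h2) _; lra.
Qed.

Lemma bounded_lipschitzX f n : BL f -> BL (fun s z => f s z ^+ n).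
Proof.
move=> fBL; elim: n => [|n IH]; first exact: bounded_lipschitz_cst.
rewrite (_ : (fun _ => _) = fun s z => f s z * f s z ^+ n).
  exact: bounded_lipschitzM.
by apply/funext => s; apply/funext => z; rewrite exprS.
Qed.

Lemma bounded_lipschitz_sum (f : nat -> R[i] -> R[i] -> R[i]) (ks : seq nat) :
  (forall k, BL (f k)) -> BL (fun s z => \sum_(k <- ks) f k s z).
Proof.
move=> fBL; elim: ks => [|k ks IH].
  rewrite (_ : (fun _ => _) = fun _ _ => 0); first exact: bounded_lipschitz_cst.
  by apply/funext => s; apply/funext => z; rewrite big_nil.
rewrite (_ : (fun _ => _) = fun s z => f k s z + \sum_(k <- ks) f k s z).
  exact: bounded_lipschitzD.
by apply/funext => s; apply/funext => z; rewrite big_cons.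
Qed.

Lemma bounded_lipschitz_expC f : BL f -> BL (fun s z => expC (f s z)).
Proof.
move=> [M M0 fM]; exists (expR M * (M + 1)) => [|s z w sr zr wr].
  by rewrite mulr_ge0 ?expR_ge0// addr_ge0.
have [f1 f2] := fM s z w sr zr wr; have [f1' _] := fM s w z sr wr zr.
split.
  by rewrite (le_trans (cnorm_expC_le f1))// ler_peMr ?expR_ge0// lerDr.
rewrite (le_trans (expC_lipschitz f1 f1'))// -mulrA ler_wpM2l ?expR_ge0//.
by rewrite (le_trans f2)// ler_wpM2r ?cnorm_ge0// lerDl.
Qed.

End ElementaryFactor.

(** * Expansion of the elementary factors *)

Section FactorJet.
Variables (R : realType) (p : nat).
Implicit Types (z w s h : R[i]) (r M : R).

Let q s z := \sum_(1 <= k < p.+1) (z * s) ^+ k / k%:R.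
(** The derivative of E_p(z s) in z, stripped of its factor - s^(p+1). *)
Let g s z := z ^+ p * expC (q s z).

Lemma elementary_factor0 : elementary_factor p (0 : R[i]) = 1.
Proof.
rewrite /elementary_factor subr0 mul1r big_nat big1 ?expC0// => k /andP[k1 _].
by rewrite expr0n; case: k k1 => // k _; rewrite mul0r.
Qed.

(** In the product rule the derivative of [q] is [s] times a geometric sum, and (1 - z s) times that
    sum is 1 - (z s)^p. The 1 cancels against the derivative of 1 - z s. *)
Lemma qderiv_elementary_factor s z :
  qderiv (fun w => elementary_factor p (w * s)) z (- (s ^+ p.+1 * g s z)).
Proof.
have q' : qderiv (q s) z (s * \sum_(i < p) (z * s) ^+ i).
  have := @qderiv_sum _ (fun k w => (s ^+ k / k%:R) * w ^+ k)
    (fun k => (s ^+ k / k%:R) * (k%:R * z ^+ k.-1)) z (index_iota 1 p.+1)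
    (fun k => qderivZ _ (qderivX z k)).
  rewrite (_ : \sum_(k <- _) _ = s * \sum_(i < p) (z * s) ^+ i); last first.
    rewrite big_add1 /= big_mkord mulr_sumr; apply: eq_bigr => i _.
    by rewrite exprMn exprS mulrA divfK ?pnatr_eq0// mulrAC -mulrA.
  rewrite (_ : (fun w => _) = q s)//; apply/funext => w; apply: eq_bigr => k _.
  by rewrite exprMn mulrAC [_ * s ^+ k]mulrC mulrAC.
have l' : qderiv (fun w => 1 - w * s) z (- s).
  have := qderivD (qderiv_cst z 1) (qderivZ (- s) (qderiv_id z)).
  rewrite add0r mulr1 (_ : (fun w => _) = fun w => 1 - w * s)//.
  by apply/funext => w; rewrite mulNr mulrC.
have := qderivM l' (qderiv_expC_comp q').
rewrite (_ : _ + _ = - (s ^+ p.+1 * g s z))//.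
have -> : (1 - z * s) * (s * (\sum_(i < p) (z * s) ^+ i) * expC (q s z)) =
    - ((z * s - 1) * (\sum_(i < p) (z * s) ^+ i) * s * expC (q s z)) by ring.
by rewrite -subrX1 exprMn /g exprS; ring.
Qed.

(* All coefficients of the expansion of E_p(z s) - 1 carry the factor
   s ^ (p + 1) of the derivative - s ^ (p + 1) z ^ p exp(q). *)
Lemma elementary_factor_jet r z : exists2 M, 0 <= M & forall s, cnorm s <= r ->
  cnorm (elementary_factor p (z * s) - 1) <= M * cnorm s ^+ p.+1 /\
  exists A B, jet (fun w => elementary_factor p (w * s)) z
    (1 + M * cnorm s ^+ p.+1) A B.
Proof.
pose rho := cnorm z + 1.
have [N N0 gN] : bounded_lipschitz g r rho.
  apply: bounded_lipschitzM; first exact/bounded_lipschitzX/bounded_lipschitz_id.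
  apply: bounded_lipschitz_expC; apply: bounded_lipschitz_sum => k.
  apply: bounded_lipschitzM; last exact: bounded_lipschitz_cst.
  apply: bounded_lipschitzX; apply: bounded_lipschitzM.
    exact: bounded_lipschitz_id.
  exact: bounded_lipschitz_param.
have z0 := cnorm_ge0 z.
(* The three summands account for the value minus 1, the linear coefficient and the remainder. *)
exists (N * cnorm z + N + N) => [|s sr]; first by rewrite !addr_ge0 ?mulr_ge0.
pose S := cnorm s ^+ p.+1.
have S0 : 0 <= S by rewrite exprn_ge0 ?cnorm_ge0.
pose f w := elementary_factor p (w * s).
pose df w := - (s ^+ p.+1 * g s w).
have fdf w : qderiv f w (df w) by exact: qderiv_elementary_factor.
have zr : cnorm z <= rho by rewrite lerDl.
have dfN w : cnorm w <= rho -> cnorm (df w) <= S * N.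
  move=> wr; rewrite /df cnormN cnormM cnormX ler_wpM2l//.
  by have [] := gN s w w sr wr wr.
(* As E_p(0) = 1, this is the mean value bound from 0 to [z]. *)
have f1 : cnorm (f z - 1) <= N * cnorm z * S.
  have -> : N * cnorm z * S = (S * N) * cnorm z by ring.
  have := @mean_value _ f df 0 z 0 (S * N) fdf.
  rewrite add0r mulr0 subr0 {2}/f mul0r elementary_factor0; apply.
  move=> t /andP[t0 t1]; rewrite subr0; apply: dfN; rewrite add0r cnormM cnorm_real.
  by rewrite ger0_norm// (le_trans _ zr)// ler_piMl.
split; first by rewrite (le_trans f1)// !mulrDl -addrA lerDl addr_ge0// mulr_ge0.
exists (f z), (df z) => h h1.
have rem : cnorm (f (z + h) - f z - h * df z) <= N * S * cnorm h ^+ 2.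
  have -> : N * S * cnorm h ^+ 2 = (N * S * cnorm h) * cnorm h by ring.
  apply: (mean_value fdf) => t /andP[t0 t1].
  have th : cnorm (t%:C * h) <= cnorm h.
    by rewrite cnormM cnorm_real ger0_norm// ler_piMl// cnorm_ge0.
  have ztr : cnorm (z + t%:C * h) <= rho.
    by rewrite (le_trans (ler_cnormD _ _))// lerD// (le_trans th).
  rewrite /df -opprD cnormN -mulrN -mulrDr cnormM cnormX -/S (mulrC N) -mulrA.
  rewrite ler_wpM2l//; have [_] := gN s (z + t%:C * h) z sr ztr zr.
  by move=> /le_trans; apply; rewrite ler_wpM2l// addrAC subrr add0r.
have MB : cnorm (f z) + cnorm (df z) <= 1 + N * cnorm z * S + N * S.
  rewrite lerD ?(mulrC N S) ?dfN//.
  by rewrite -[f z](subrK 1) (le_trans (ler_cnormD _ _))// cnorm1 addrC lerD.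
(* The coefficient of h^2 is a quotient by h^2; at h = 0 any small value serves, and 0 is taken. *)
have [h0|h0] := eqVneq h 0.
  exists 0; first by rewrite h0 !(mulr0, mul0r, addr0).
  rewrite cnorm0 addr0 (le_trans MB)// !mulrDl -!addrA !lerD2l lerDl mulr_ge0//.
exists ((f (z + h) - f z - h * df z) / h ^+ 2).
  by rewrite [h ^+ 2 * _]mulrC divfK ?expf_neq0// /f; ring.
rewrite cnormM cnormV cnormX !mulrDl !addrA lerD// ler_pdivrMr//.
by rewrite exprn_gt0// lt_neqAle cnorm_ge0 eq_sym cnorm_eq0 h0.
Qed.

End FactorJet.

(** * Unordered products with summable deviations from 1 *)

Section AbsolutelyConvergentProducts.
Variables (R : realType) (T : choiceType) (S : set T) (a : T -> R[i]).
Variables (eps : T -> R) (B : R).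
Hypothesis aeps : forall x, S x -> cnorm (a x - 1) <= eps x.
Implicit Types (s F : seq T) (e : nat -> option T).

Definition seq_in s := forall x, x \in s -> S x.

(** Summability as a bound on all finite subsums, which involves no enumeration. *)
Hypothesis epsB : forall s, uniq s -> seq_in s -> \sum_(x <- s) eps x <= B.

(** Induction on a b - 1 = (a - 1)(b - 1) + (a - 1) + (b - 1), an identity that the majorant exp - 1
    satisfies as well. *)
Lemma prod_sub1_le s : seq_in s ->
  cnorm (\prod_(x <- s) a x - 1) <= expR (\sum_(x <- s) eps x) - 1.
Proof.
elim: s => [|x s IH] sS; first by rewrite !big_nil expR0 !subrr cnorm0.
have Sx : S x by apply: sS; rewrite mem_head.
rewrite !big_cons expRD; set P := \prod_(_ <- _) _; set t := \sum_(_ <- _) _.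
have {IH} IH : cnorm (P - 1) <= expR t - 1.
  by apply: IH => y ys; apply: sS; rewrite in_cons ys orbT.
have ax : cnorm (a x - 1) <= expR (eps x) - 1.
  by rewrite (le_trans (aeps Sx))// lerBrDr addrC expR_ge1Dx.
rewrite (_ : a x * P - 1 = (a x - 1) * (P - 1) + (a x - 1) + (P - 1)); last by ring.
apply: le_trans (ler_cnormD _ _) _.
apply: le_trans (lerD (ler_cnormD _ _) (lexx _)) _; rewrite cnormM.
have h := ler_pM (cnorm_ge0 _) (cnorm_ge0 _) ax IH.
apply: le_trans (lerD (lerD h (lexx _)) (lexx _)) _; lra.
Qed.

Lemma prod_le s : uniq s -> seq_in s -> cnorm (\prod_(x <- s) a x) <= expR B.
Proof.
move=> us sS; rewrite -[X in cnorm X](subrK 1) (le_trans (ler_cnormD _ _))//.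
rewrite cnorm1 -lerBrDr (le_trans (prod_sub1_le sS))// lerD2r ler_expR.
exact: epsB.
Qed.

(** [F0] comes within [d] of the supremum of the finite sums, so a disjoint [F] can add at most
    [d]. *)
Lemma sum_tail (d : R) : 0 < d -> exists F0, [/\ uniq F0, seq_in F0 &
  forall F, uniq F -> seq_in F -> (forall x, x \in F -> x \notin F0) ->
    \sum_(x <- F) eps x <= d].
Proof.
move=> d0; pose sums := [set \sum_(x <- s) eps x | s in [set s | uniq s /\ seq_in s]].
have sums_sup : has_sup sums.
  split; first by exists (\sum_(x <- [::]) eps x), [::].
  by exists B => _ [s [us sS] <-]; exact: epsB.
have [_ [F0 [uF0 F0S] <-] lt0] := sup_adherent d0 sums_sup.
exists F0; split=> // F uF FS FF0.
have : \sum_(x <- F0 ++ F) eps x <= sup sums.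
  apply: ub_le_sup; first by case: sums_sup.
  exists (F0 ++ F) => //; split; last by move=> x; rewrite mem_cat => /orP[/F0S|/FS].
  by rewrite cat_uniq uF0 uF andbT; apply/hasPn.
rewrite big_cat/=; lra.
Qed.

Lemma prod_tail (d : R) : 0 < d -> exists F0, [/\ uniq F0, seq_in F0 &
  forall F, uniq F -> seq_in F -> (forall x, x \in F -> x \notin F0) ->
    cnorm (\prod_(x <- F) a x - 1) <= d].
Proof.
move=> d0; have d10 : 0 < d + 1 by lra.
have [|F0 [uF0 F0S F0P]] := @sum_tail (ln (d + 1)); first by rewrite ln_gt0//; lra.
exists F0; split=> // F uF FS FF0; rewrite (le_trans (prod_sub1_le FS))// lerBlDr.
by rewrite -[leRHS]lnK// ler_expR F0P.
Qed.

(** A Cauchy criterion along finite subsets, which lets different enumerations be compared. The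
    factors outside [F0] multiply to nearly 1, and the product over [F0] is at most exp(B). *)
Lemma prod_near (d : R) : 0 < d -> exists F0, [/\ uniq F0, seq_in F0 &
  forall F, uniq F -> seq_in F -> {subset F0 <= F} ->
    cnorm (\prod_(x <- F) a x - \prod_(x <- F0) a x) <= d].
Proof.
move=> d0; have dB0 : 0 < d / expR B by rewrite divr_gt0 ?expR_gt0.
have [F0 [uF0 F0S F0P]] := prod_tail dB0.
exists F0; split=> // F uF FS F0F.
rewrite (bigID [in F0])/= -[X in X * _ - _]big_filter -[X in _ * X - _]big_filter.
rewrite (perm_big F0)/=; last first.
  apply: uniq_perm; rewrite ?filter_uniq// => x; rewrite mem_filter.
  by apply: andb_idr; exact: F0F.
set Q := \prod_(x <- seq.filter _ F) _; set P := \prod_(x <- F0) _.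
rewrite (_ : P * Q - P = P * (Q - 1)); last by ring.
have := F0P [seq x <- F | x \notin F0] (filter_uniq _ uF).
rewrite ler_pdivlMr ?expR_gt0// mulrC -/Q cnormM => QP.
apply: (le_trans (ler_wpM2r (cnorm_ge0 _) (prod_le uF0 F0S))); apply: QP => x.
  by rewrite mem_filter => /andP[_ /FS].
by rewrite mem_filter => /andP[].
Qed.

Section Enumeration.
Variables (e : nat -> option T) (eS : enumerates e S).

Let u n := oapp a 1 (e n).
(** [pmap] drops the [None] padding, so a block is a duplicate-free list of points of [S]. *)
Let block m n := pmap e (index_iota m n).

Lemma block_in m n : seq_in (block m n).
Proof.
move=> x; rewrite mem_pmap => /mapP[k _ /esym ek].
by apply/eS.1; exists k.
Qed.

Lemma block_uniq m n : uniq (block m n).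
Proof.
rewrite /block; have := iota_uniq m (n - m); rewrite -/(index_iota m n).
elim: (index_iota m n) => //= k s IH /andP[ks us].
case ek : (e k) => [x|]/=; last exact: IH.
rewrite IH// andbT mem_pmap; apply/mapP => -[j js /esym ej].
by move: ks; rewrite (eS.2 _ _ _ ek ej) js.
Qed.

Lemma prod_block m n : \prod_(m <= k < n) u k = \prod_(x <- block m n) a x.
Proof.
rewrite /block; elim: (index_iota m n) => [|k s IH]; first by rewrite !big_nil.
by rewrite big_cons IH /u /=; case: (e k) => [x|]/=; rewrite ?big_cons ?mul1r.
Qed.

Lemma block_sub F : seq_in F -> exists N, forall n, (N <= n)%N -> {subset F <= block 0 n}.
Proof.
elim: F => [|x F IH] FS; first by exists 0%N.
have [|N NP] := IH; first by move=> y yF; apply: FS; rewrite in_cons yF orbT.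
have [k ek] := (eS.1 x).1 (FS x (mem_head _ _)).
exists (maxn N k.+1) => n; rewrite geq_max => /andP[Nn kn] y.
rewrite in_cons => /predU1P[->|]; last exact: NP.
by rewrite mem_pmap -ek map_f// mem_index_iota.
Qed.

Lemma block_disjoint F N m n : {subset F <= block 0 N} -> (N <= m)%N ->
  forall x, x \in block m n -> x \notin F.
Proof.
move=> FN Nm x; rewrite mem_pmap => /mapP[k + /esym ek].
rewrite mem_index_iota => /andP[mk _]; apply/negP => /FN.
rewrite mem_pmap => /mapP[j + /esym ej]; rewrite mem_index_iota /= => jN.
by move: (leq_trans Nm mk); rewrite (eS.2 _ _ _ ek ej) leqNgt jN.
Qed.

Lemma prod_tail_enum (d : R) : 0 < d -> exists N, forall m n, (N <= m)%N ->
  cnorm (\prod_(m <= k < n) u k - 1) <= d.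
Proof.
move=> /prod_tail[F0 [uF0 F0S F0P]]; have [N NP] := block_sub F0S.
exists N => m n Nm; rewrite prod_block; apply: F0P.
- exact: block_uniq.
- exact: block_in.
- exact: block_disjoint (NP _ (leqnn N)) Nm.
Qed.

Lemma infinite_prod_enum : exists l, infinite_prod u l.
Proof.
(* Products starting at [N] stay within 1/2 of 1, hence their limit is nonzero even if earlier
   factors vanish. *)
have [|N NP] := @prod_tail_enum (1 / 2); first lra.
have [q Pq] : exists q : R[i], \prod_(N <= k < n) u k @[n --> \oo] --> q.
  apply: cauchyC => d d0.
  have [|M MP] := @prod_tail_enum (d / expR B); first by rewrite divr_gt0 ?expR_gt0.
  exists (maxn N M) => n Mn.
  (* The difference of partial products is a product bounded by exp(B) times a tail product minus
     1. *)
  rewrite (big_cat_nat (leq_maxl _ _) Mn)/= -[X in _ - X]mulr1 -mulrBr cnormM.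
  have := MP _ n (leq_maxr N M); rewrite ler_pdivlMr ?expR_gt0// mulrC.
  apply: le_trans; rewrite ler_wpM2r ?cnorm_ge0// prod_block.
  by apply: prod_le; [exact: block_uniq|exact: block_in].
exists (\prod_(k < N) u k * q), N, q; split=> //.
apply/eqP => q0; rewrite q0 in Pq.
have [|M /(_ _ (leqnn M)) MP] := (cvgnCP _ _).1 Pq (1 / 4); first lra.
have := ler_cnorm_sub 0 1 (\prod_(N <= k < M) u k).
have := NP N M (leqnn N); rewrite [cnorm (0 - 1)]cnormB subr0 cnorm1; lra.
Qed.

End Enumeration.

Lemma infinite_prod_cvg (v : nat -> R[i]) l : infinite_prod v l ->
  \prod_(0 <= k < n) v k @[n --> \oo] --> l.
Proof.
move=> [N [q [_ vq ->]]]; apply/cvgnCP => d d0.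
set P := \prod_(k < N) v k; have P1 : 0 < cnorm P + 1 by rewrite ltr_wpDl ?cnorm_ge0.
have [|M MP] := (cvgnCP _ _).1 vq (d / (cnorm P + 1)); first by rewrite divr_gt0.
exists (maxn M N) => n; rewrite geq_max => /andP[Mn Nn].
rewrite (big_cat_nat (leq0n N) Nn)/= big_mkord -/P -mulrBr cnormM.
have := MP n Mn; rewrite ler_pdivlMr// mulrDr mulr1 mulrC; apply: le_trans.
by rewrite lerDl cnorm_ge0.
Qed.

(** Long initial blocks of both enumerations contain the same [F0], so both partial products are
    close to the product over [F0]; four errors of d/4 add up. *)
Lemma infinite_prod_enum_unique e e' l l' : enumerates e S -> enumerates e' S ->
  infinite_prod (fun n => oapp a 1 (e n)) l ->
  infinite_prod (fun n => oapp a 1 (e' n)) l' -> l = l'.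
Proof.
move=> eS e'S /infinite_prod_cvg/cvgnCP el /infinite_prod_cvg/cvgnCP e'l.
apply/eqP; rewrite -subr_eq0 -cnorm_eq0 eq_le cnorm_ge0 andbT.
apply/ler_addgt0Pl => d d0; rewrite addr0.
have d40 : 0 < d / 4 by lra.
have [F0 [uF0 F0S F0P]] := prod_near d40.
have [N1 N1P] := el _ d40; have [N2 N2P] := e'l _ d40.
have [N3 N3P] := block_sub eS F0S; have [N4 N4P] := block_sub e'S F0S.
pose n := maxn (maxn N1 N2) (maxn N3 N4).
have := N1P n (leq_trans (leq_maxl _ _) (leq_maxl _ _)).
have := N2P n (leq_trans (leq_maxr _ _) (leq_maxl _ _)).
have := F0P _ (block_uniq eS 0 n) (@block_in _ eS 0 n)
  (N3P n (leq_trans (leq_maxl _ _) (leq_maxr _ _))).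
have := F0P _ (block_uniq e'S 0 n) (@block_in _ e'S 0 n)
  (N4P n (leq_trans (leq_maxr _ _) (leq_maxr _ _))).
rewrite -!prod_block; set P := \prod_(x <- F0) _.
set u := \prod_(0 <= k < n) oapp a 1 (e k).
set u' := \prod_(0 <= k < n) oapp a 1 (e' k) => H1 H2 H3 H4.
have := ler_cnorm_sub l l' u; have := ler_cnorm_sub u l' P.
have := ler_cnorm_sub P l' u'; rewrite (cnormB P u') (cnormB u' l'); lra.
Qed.

Lemma ex_enumerates : countable S -> exists e, enumerates e S.
Proof.
move=> /countable_injP[f finj].
(* The injection [f] into nat is inverted on its range, with [None] elsewhere. *)
exists (fun n => if pselect (exists x, S x /\ f x = n) is left ex
                 then Some (sval (cid ex)) else None); split.
  move=> x; split=> [Sx|[n]].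
    exists (f x); case: pselect => [ex|[]]; last by exists x.
    by case: cid => y [Sy fy] /=; congr Some; apply: finj; rewrite ?inE.
  by case: pselect => // ex [<-]; case: cid => y [].
move=> m n x; case: pselect => // ex [<-]; case: pselect => // ex' [].
have [_ fm] := svalP (cid ex); have [_ fn] := svalP (cid ex') => eqx.
by rewrite -fm -fn eqx.
Qed.

Lemma ex_unordered_prod : countable S -> unordered_prod_converges S a.
Proof.
move=> cS; have [e eS] := ex_enumerates cS; have [l el] := infinite_prod_enum eS.
exists l; split=> // e' e'S; have [l' e'l'] := infinite_prod_enum e'S.
by rewrite (infinite_prod_enum_unique eS e'S el e'l').
Qed.

Lemma unordered_prod_cvg e : countable S -> enumerates e S ->
  \prod_(0 <= k < n) oapp a 1 (e k) @[n --> \oo] --> unordered_prod S a.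
Proof.
move=> cS eS; apply: infinite_prod_cvg.
by have [_ prodS] := getPex (ex_unordered_prod cS); exact: prodS.
Qed.

End AbsolutelyConvergentProducts.

(** * Weierstrass products over a set with summable inverse powers *)

Section WeierstrassCriterion.
Variable R : realType.

Lemma jet_le (F : R[i] -> R[i]) z M N A B : M <= N -> jet F z M A B -> jet F z N A B.
Proof. by move=> MN FJ h /FJ[c ? cM]; exists c => //; exact: le_trans MN. Qed.

Lemma big_oapp (V : Type) (idx : V) (op : Monoid.law idx) (T : Type) (s : seq nat)
    (e : nat -> option T) (f : T -> V) :
  \big[op/idx]_(k <- s) oapp f idx (e k) = \big[op/idx]_(x <- pmap e s) f x.
Proof.
elim: s => [|k s IH]; first by rewrite !big_nil.
by rewrite big_cons IH /=; case: (e k) => [x|]/=; rewrite ?big_cons ?Monoid.mul1m.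
Qed.

Lemma prod_1D_le (T : Type) (s : seq T) (f : T -> R) : (forall x, 0 <= f x) ->
  \prod_(x <- s) (1 + f x) <= expR (\sum_(x <- s) f x).
Proof.
move=> f0; rewrite expR_sum; apply: ler_prod => x _.
by rewrite expR_ge1Dx addr_ge0 ?f0.
Qed.

(** The bound [r] puts all parameters 1/x in one disc, so at each [z] a single [M] serves every
    factor. The jets of the partial products then have norm at most the product of the 1 + M
    |x|^-(p+1), hence at most exp(M B), uniformly in their length. *)
Lemma weierstrass_criterion (S : set R[i]) (p : nat) (r B : R) :
  countable S -> (forall x, S x -> cnorm x^-1 <= r) ->
  (forall s, uniq s -> seq_in S s -> \sum_(x <- s) cnorm x^-1 ^+ p.+1 <= B) ->
  (forall z, unordered_prod_converges S (Pi_factor p z)) /\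
  entire (fun z => unordered_prod S (Pi_factor p z)).
Proof.
move=> cS Sr SB; have [e eS] := ex_enumerates cS.
pose w M (x : R[i]) := M * cnorm x^-1 ^+ p.+1.
have w0 M x : 0 <= M -> 0 <= w M x by move=> M0; rewrite mulr_ge0 ?exprn_ge0 ?cnorm_ge0.
have wB M : 0 <= M -> forall s, uniq s -> seq_in S s -> \sum_(x <- s) w M x <= M * B.
  by move=> M0 s us sS; rewrite -mulr_sumr ler_wpM2l// SB.
have cvgS z : unordered_prod_converges S (Pi_factor p z) /\
    \prod_(0 <= k < n) oapp (Pi_factor p z) 1 (e k) @[n --> \oo] -->
    unordered_prod S (Pi_factor p z).
  have [M M0 MP] := elementary_factor_jet p r z.
  have Sw x : S x -> cnorm (Pi_factor p z x - 1) <= w M x.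
    by move=> /Sr /MP[].
  split; first exact: (ex_unordered_prod Sw (wB _ M0) cS).
  exact: (unordered_prod_cvg Sw (wB _ M0) cS eS).
split=> z; first by have [] := cvgS z.
have [M M0 MP] := elementary_factor_jet p r z.
apply: (@jet_lim_derivable _ (fun n v => \prod_(k < n) oapp (Pi_factor p v) 1 (e k))
  _ _ (expR (M * B))); last first.
  move=> v; have [_] := cvgS v; apply: cvg_trans; apply: near_eq_cvg.
  by near=> n; rewrite big_mkord.
move=> n.
have [|A [A' AA']] := @jet_prod _ (fun k v => oapp (Pi_factor p v) 1 (e k)) z
  (fun k => 1 + oapp (w M) 0 (e k)) _ n.
  move=> k; case ek : (e k) => [x|]/=; last by exists 1, 0; rewrite addr0; exact: jet1.
  by have /Sr/MP[_] : S x by apply/eS.1; exists k.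
exists A, A'; apply: jet_le AA'.
rewrite -(big_mkord xpredT (fun k => 1 + oapp (w M) 0 (e k))).
rewrite (le_trans (prod_1D_le _ _))//.
  by move=> k; case: (e k) => //= x; exact: w0.
rewrite big_oapp ler_expR wB//; first exact: block_uniq eS 0 n.
exact: (@block_in _ _ _ eS 0 n).
Unshelve. all: by end_near. Qed.

End WeierstrassCriterion.

(** * Compactness and area of squares *)

Section Squares.
Variable R : realType.
Implicit Types (z w : R[i]) (r : R).

Lemma cnorm_continuous : continuous (@cnorm R : R[i] -> R).
Proof.
move=> z; apply/(@cvgrPdist_le _ _ _ (nbhs z)) => e e0; near=> w.
have zw : cnorm (z - w) <= e.
  near: w; apply/nbhs_ballP; exists e%:C => /=; first by rewrite ltcR.
  by move=> w /=; rewrite /ball /= normC_cnorm ltcR => /ltW.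
have := ler_cnorm_sub z 0 w; have := ler_cnorm_sub w 0 z.
by rewrite !subr0 (cnormB w z) ler_norml; lra.
Unshelve. all: by end_near. Qed.

(** Squares stand in for discs: as images of rectangles under [plane], they have evident compactness
    and area. *)
Definition square r : set R[i] :=
  [set z | `|complex.Re z| <= r /\ `|complex.Im z| <= r].

Lemma cnorm_square z r : cnorm z <= r -> square r z.
Proof.
by split; [exact: le_trans (Re_le_cnorm z) _|exact: le_trans (Im_le_cnorm z) _].
Qed.

Lemma preimage_square r : @plane R @^-1` square r = `[- r, r] `*` `[- r, r].
Proof.
by apply/seteqP; split => -[x y]; rewrite /square /= !in_itv/= -!ler_norml.
Qed.

Lemma square_compact r : compact (square r).
Proof.
have -> : square r = (fun w : R * R => w.1 +i* w.2) @` (`[- r, r] `*` `[- r, r]).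
  rewrite -preimage_square; apply/seteqP; split => [[x y] xy|_ [w wr <-]//].
  by exists (x, y).
apply: continuous_compact; last by apply: compact_setX; exact: segment_compact.
apply: continuous_subspaceT => w; apply/(@cvgCP _ _ (nbhs w)) => e e0.
have e20 : 0 < e / 2 by lra.
have near1 : \forall v \near w, `|w.1 - v.1| <= e / 2.
  exact: (@cvgrPdist_le _ _ _ (nbhs w) _ fst w.1).1 cvg_fst _ e20.
have near2 : \forall v \near w, `|w.2 - v.2| <= e / 2.
  exact: (@cvgrPdist_le _ _ _ (nbhs w) _ snd w.2).1 cvg_snd _ e20.
near=> v.
have wv1 : `|w.1 - v.1| <= e / 2 by near: v.
have wv2 : `|w.2 - v.2| <= e / 2 by near: v.
by apply: le_trans (cnorm_le_ReIm _) _ => /=; lra.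
Unshelve. all: by end_near. Qed.

Lemma open_measurable_borelC (U : set R[i]) :
  open U -> measurable (U : set (borelC R)).
Proof. by move=> oU; apply: sub_sigma_algebra. Qed.

Lemma square_closed r : closed (square r).
Proof. by apply: compact_closed; [exact: norm_hausdorff|exact: square_compact]. Qed.

Lemma measurable_square r : measurable (square r : set (borelC R)).
Proof.
rewrite -[square r]setCK; apply: measurableC; apply: open_measurable_borelC.
exact/closed_openC/square_closed.
Qed.

Lemma lebesgueC_square r : 0 <= r -> lebesgueC R (square r) = ((2 * r) ^+ 2)%:E.
Proof.
move=> r0; rewrite /lebesgueC /pushforward preimage_square.
rewrite product_measure1E; [|exact: measurable_itv|exact: measurable_itv].
rewrite [X in (X * _)%E]lebesgue_measure_itv [X in (_ * X)%E]lebesgue_measure_itv/=.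
(* The length formula distinguishes whether - r < r; otherwise r = 0 and both sides vanish. *)
rewrite lte_fin; have [rr|rr] := ltP (- r) r.
  by rewrite -EFinB -EFinM; congr (_%:E); ring.
have -> : r = 0 by lra.
by rewrite mule0 mulr0 expr0n.
Qed.

Lemma continuous_measurable_borelC (f : R[i] -> R) : continuous f ->
  measurable_fun [set: borelC R] (f : borelC R -> R).
Proof.
move=> cf; apply: (measurability _ (RGenOpens.measurableE R)).
move=> _ [_ [a [b ->]] <-]; rewrite setTI; apply: open_measurable_borelC.
by apply: open_comp => // x _; exact: cf.
Qed.

End Squares.

(** * Compactly supported minorants of a multiple of the inverse cube *)

Section Bumps.
Variable R : realType.
Implicit Types (z : R[i]) (k m n : nat).

Definition tent k z : R := Num.max 0 (Num.min 1 (2 - cnorm z / 2 ^+ k)).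

(** At modulus about 2^k the weight 8^-k is comparable to |z|^-3, while the support of [tent k] has
    area of order 4^k: the integrals are dominated by a geometric series. *)
Definition bump n z : R := \sum_(k < n) (8 ^+ k)^-1 * tent k z.

Lemma tent_ge0 k z : 0 <= tent k z.
Proof. by rewrite le_max lexx. Qed.

Lemma tent_le1 k z : tent k z <= 1.
Proof. by rewrite ge_max ler01 ge_min lexx. Qed.

Lemma tent_eq1 k z : cnorm z <= 2 ^+ k -> tent k z = 1.
Proof.
move=> zk; rewrite /tent min_l; first by rewrite max_r.
have : cnorm z / 2 ^+ k <= 1 by rewrite ler_pdivrMr ?exprn_gt0// mul1r.
lra.
Qed.

Lemma tent_support k z : tent k z != 0 -> cnorm z <= 2 ^+ k.+1.
Proof.
apply: contraNT; rewrite -ltNge => zk; rewrite /tent max_l//.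
have : 2 < cnorm z / 2 ^+ k by rewrite ltr_pdivlMr ?exprn_gt0// -exprS.
by rewrite ge_min; lra.
Qed.

Lemma tent_continuous k : continuous (tent k : R[i] -> R).
Proof.
move=> z.
suff : {for z, continuous (cst 0 \max (cst 1 \min
    (fun w : R[i] => 2 - cnorm w / 2 ^+ k : R^o)))} by [].
apply: continuous_max; first exact: cst_continuous.
apply: continuous_min; first exact: cst_continuous.
apply: (@cvgB _ _ _ (nbhs z)); first exact: cvg_cst.
by apply: (@cvgMl _ _ (nbhs z)); exact: cnorm_continuous.
Qed.

Lemma bump_continuous n : continuous (bump n : R[i] -> R).
Proof.
elim: n => [|n IH] z.
  rewrite (_ : bump 0 = cst 0); first exact: cst_continuous.
  by apply/funext => w; rewrite /bump big_ord0.
rewrite (_ : bump n.+1 = fun w => bump n w + (8 ^+ n)^-1 * tent n w); last first.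
  by apply/funext => w; rewrite /bump big_ord_recr.
apply: (@cvgD _ _ _ (nbhs z)); first exact: IH.
by apply: (@cvgMr _ _ (nbhs z)); exact: tent_continuous.
Qed.

Lemma bump_term_ge0 k z : 0 <= (8 ^+ k)^-1 * tent k z.
Proof. by rewrite mulr_ge0 ?tent_ge0// invr_ge0 exprn_ge0. Qed.

Lemma bump_ge0 n z : 0 <= bump n z.
Proof. by apply: sumr_ge0 => k _; exact: bump_term_ge0. Qed.

Lemma bump_le m n z : (m <= n)%N -> bump m z <= bump n z.
Proof.
move=> mn; rewrite /bump -!(big_mkord xpredT (fun k => (8 ^+ k)^-1 * tent k z)).
rewrite (big_cat_nat (leq0n m) mn)/= lerDl.
by apply: sumr_ge0 => k _; exact: bump_term_ge0.
Qed.

Lemma geometric_half_le n : \sum_(k < n) (2 ^+ k)^-1 <= 2 :> R.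
Proof.
rewrite [leLHS](_ : _ = 2 - 2 * (2 ^+ n)^-1); last first.
  elim: n => [|n IH]; first by rewrite big_ord0 expr0 invr1; ring.
  rewrite big_ord_recr/= IH exprS invfM; lra.
by rewrite gerBl mulr_ge0// invr_ge0 exprn_ge0.
Qed.

Lemma bump_le2 n z : bump n z <= 2.
Proof.
apply: le_trans (geometric_half_le n); apply: ler_sum => k _.
rewrite -[leRHS]mulr1 ler_pM ?tent_ge0 ?tent_le1 ?invr_ge0 ?exprn_ge0//.
by rewrite lef_pV2 ?posrE ?exprn_gt0// lerXn2r// ?nnegrE; lra.
Qed.

(** Every index is some k < n, and [tent k] vanishes beyond radius 2^(k+1) <= 2^n. *)
Lemma bump_support n z : bump n z != 0 -> square (2 ^+ n) z.
Proof.
move=> bn; apply: contrapT => zn; move: bn; rewrite /bump big1 ?eqxx// => k _.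
have [->|/tent_support zk] := eqVneq (tent k z) 0; first by rewrite mulr0.
by case: zn; apply: cnorm_square; rewrite (le_trans zk)// ler_weXn2l// ler1n.
Qed.

Lemma bump_C0 n : C0 (bump n : R[i] -> R).
Proof.
split; first exact: bump_continuous.
apply: (subclosed_compact _ (@square_compact R (2 ^+ n))); first exact: closed_closure.
rewrite [X in _ `<=` X](closure_id _).1; last exact: square_closed.
by apply: closure_subset => z; exact: bump_support.
Qed.

(** Let [k] be least with |z| <= 2^k; then [bump n z] is at least 8^-k for n > k. If k > 0,
    minimality gives |z| > 2^(k-1), whence the constant 8; if k = 0, the bound by [r] gives r^3. *)
Lemma inv_cube_le_bump (r : R) z : z != 0 -> cnorm z^-1 <= r ->
  exists N, forall n, (N <= n)%N -> cnorm z^-1 ^+ 3 <= (8 + r ^+ 3) * bump n z.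
Proof.
move=> z0 zr; have r0 := le_trans (cnorm_ge0 _) zr.
have cz0 : 0 < cnorm z by rewrite lt_neqAle cnorm_ge0 eq_sym cnorm_eq0 z0.
have exk : exists k, cnorm z <= 2 ^+ k.
  exists (Num.trunc (cnorm z)).+1; rewrite (le_trans (ltW (truncnS_gt _)))//.
  by rewrite -natrX ler_nat ltnW// ltn_expl.
pose k := ex_minn exk; exists k.+1 => n kn.
have [zk kmin] : cnorm z <= 2 ^+ k /\ forall m, cnorm z <= 2 ^+ m -> (k <= m)%N.
  by rewrite /k; case: ex_minnP.
have bk : (8 ^+ k)^-1 <= bump n z.
  rewrite (le_trans _ (bump_le z kn))// /bump big_ord_recr/= tent_eq1// mulr1 lerDr.
  by apply: sumr_ge0 => j _; exact: bump_term_ge0.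
rewrite (le_trans _ (ler_wpM2l _ bk)) ?addr_ge0 ?exprn_ge0//.
case: k zk kmin {bk kn} => [|k] zk kmin.
  by rewrite expr0 invr1 mulr1 ler_wpDl// lerXn2r ?nnegrE ?cnorm_ge0.
have zk' : 2 ^+ k < cnorm z by rewrite ltNge; apply/negP => /kmin; rewrite ltnn.
rewrite mulrDl ler_wpDr ?mulr_ge0 ?invr_ge0 ?exprn_ge0//.
rewrite [8 ^+ k.+1]exprS invfM mulrA divff// mul1r (_ : 8 = 2 ^+ 3); last by ring.
rewrite -exprM mulnC exprM -exprVn lerXn2r ?nnegrE ?cnorm_ge0 ?invr_ge0 ?exprn_ge0//.
by rewrite cnormV lef_pV2 ?posrE ?exprn_gt0// ltW.
Qed.

End Bumps.

(** * Pairings as finite sums *)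

Section Pairing.
Variable R : realType.
Implicit Types (f : R[i] -> R) (gamma : configuration R).

Lemma points_square gamma (r : R) : finite_set (points gamma `&` square r).
Proof.
rewrite setIC; have := valP gamma; rewrite inE; apply; exact: square_compact.
Qed.

(** Only finitely many points lie in the square that carries [f], so the pairing is a sum over a
    list; that list can be made to extend any given [s], which yields lower bounds by partial
    sums. *)
Lemma pairing_seq f gamma (s : seq R[i]) (r : R) :
  (forall z, f z != 0 -> square r z) -> uniq s -> seq_in (points gamma) s ->
  exists s', [/\ uniq (s ++ s'), seq_in (points gamma) (s ++ s') &
    pairing f gamma = \sum_(x <- s ++ s') f x].
Proof.
move=> fr us sg.
pose t := finmap.enum_fset (fset_set (points gamma `&` square r)).
have tE x : (x \in t) = (x \in points gamma `&` square r).
  by rewrite -(in_fset_set (points_square gamma r)).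
exists [seq x <- t | x \notin s].
have sub : seq_in (points gamma) (s ++ [seq x <- t | x \notin s]).
  move=> x; rewrite mem_cat mem_filter => /orP[/sg//|/andP[_]].
  by rewrite tE inE => -[].
have uni : uniq (s ++ [seq x <- t | x \notin s]).
  rewrite cat_uniq us filter_uniq ?finmap.fset_uniq// andbT.
  by apply/hasPn => x; rewrite mem_filter => /andP[].
split=> //; rewrite /pairing (fsbigE (s ++ [seq x <- t | x \notin s]))//.
- by rewrite big_seq_cond [RHS]big_seq; apply: eq_bigl => x;
    apply: andb_idr => /sub xg; rewrite inE.
- move=> x xg; rewrite mem_cat mem_filter negb_or negb_and negbK => /andP[xs].
  rewrite (negbTE xs)/= tE; apply: contraNeq => /fr xr; rewrite inE; exact: conj.
Qed.

Lemma pairing_ge_sum f gamma (s : seq R[i]) (r : R) :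
  (forall z, f z != 0 -> square r z) -> (forall z, 0 <= f z) ->
  uniq s -> seq_in (points gamma) s -> \sum_(x <- s) f x <= pairing f gamma.
Proof.
move=> fr f0 us sg; have [s' [_ _ ->]] := pairing_seq fr us sg.
by rewrite big_cat/= lerDl sumr_ge0.
Qed.

Lemma pairing_bump_le m n gamma : (m <= n)%N ->
  pairing (bump m) gamma <= pairing (bump n) gamma.
Proof.
move=> mn.
have [//|//|s [us sg ->]] := @pairing_seq (bump m) gamma [::] _ (@bump_support R m).
rewrite (le_trans (ler_sum _ (fun x _ => bump_le x mn)))//.
exact: (pairing_ge_sum (@bump_support R n) (bump_ge0 n)).
Qed.

Lemma measurable_pairing f : C0 f ->
  measurable_fun [set: Gamma R] (pairing f : Gamma R -> R).
Proof.
move=> C0f _ Y mY; apply: sub_sigma_algebra.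
by exists f => //; exists Y.
Qed.

End Pairing.

(** * Uniform exponential moments and almost sure boundedness *)

Section ExponentialMoments.
Variable R : realType.
Local Open Scope ereal_scope.

(** As the bumps are at most 2 for every [n], exp(u) - 1 <= exp(2) u holds with one constant; each
    tent is then dominated by the indicator of a square containing its support. *)
Lemma expR_bump_sub1_le n (z : R[i]) :
  (expR (bump n z) - 1 <=
   \sum_(k < n) expR 2 * (8 ^+ k)^-1 * \1_(square (2 ^+ k.+1)) z)%R.
Proof.
have b2 : (`|bump n z| <= 2)%R by rewrite ger0_norm ?bump_ge0// bump_le2.
apply: (le_trans (ler_norm _)); apply: (le_trans (expR_sub1_le b2)).
rewrite ger0_norm ?bump_ge0// mulr_sumr; apply: ler_sum => k _.
rewrite mulrA ler_wpM2l ?mulr_ge0 ?expR_ge0 ?invr_ge0 ?exprn_ge0//.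
have [->|/tent_support zk] := eqVneq (tent k z) 0%R; first by rewrite indicE.
by rewrite indicE mem_set ?tent_le1//; exact: cnorm_square.
Qed.

Lemma integral_expR_bump_le n :
  \int[lebesgueC R]_x (expR (bump n x) - 1)%:E <= (32 * expR 2)%:E.
Proof.
pose c k : R := (expR 2 * (8 ^+ k)^-1)%R.
have c0 k : (0 <= c k)%R by rewrite mulr_ge0 ?expR_ge0 ?invr_ge0 ?exprn_ge0.
pose ind (k : nat) (x : borelC R) : \bar R := (\1_(square (2 ^+ k.+1)) x)%:E.
pose F (k : nat) (x : borelC R) : \bar R := (c k)%:E * ind k x.
have mI k : measurable_fun [set: borelC R] (ind k).
  by apply/measurable_EFinP; apply: measurable_indic; exact: measurable_square.
have mF k : measurable_fun [set: borelC R] (F k) by exact: measurable_funeM.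
have F0 k x : 0 <= F k x by rewrite mule_ge0 ?lee_fin.
rewrite (@le_trans _ _ (\int[lebesgueC R]_x \sum_(k <- index_iota 0 n) F k x))//.
  apply: ge0_le_integral => //.
  - by move=> x _; rewrite lee_fin subr_ge0 -expR0 ler_expR bump_ge0.
  - apply/measurable_EFinP; apply: measurable_funB; last exact: measurable_cst.
    apply: (measurableT_comp (@measurable_expR R)).
    by apply: continuous_measurable_borelC; exact: bump_continuous.
  - by apply: emeasurable_sum => k; exact: mF.
  - move=> x _; rewrite big_mkord; under eq_bigr do rewrite /F /ind -EFinM.
    by rewrite sumEFin lee_fin expR_bump_sub1_le.
rewrite ge0_integral_sum//.
(* The square has area 16 * 4^k, so the weight 8^-k leaves 16 * 2^-k. *)
rewrite (eq_bigr (fun k => (16 * expR 2 * (2 ^+ k)^-1)%:E)); last first.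
  move=> k _; rewrite /F ge0_integralZl//; last by rewrite lee_fin.
    rewrite integral_indic//; last exact: measurable_square.
    rewrite setIT [X in _ * X](lebesgueC_square _) ?exprn_ge0// -EFinM /c; congr (_%:E).
    have -> : (8 ^+ k = (2 ^+ k) ^+ 3 :> R)%R.
      by rewrite -exprM mulnC exprM; congr (_ ^+ k)%R; ring.
    by rewrite [(2 ^+ k.+1)%R]exprS; field; rewrite expf_neq0.
  by move=> x _; rewrite lee_fin.
rewrite sumEFin lee_fin big_mkord -mulr_sumr.
rewrite (_ : 32 * expR 2 = 16 * expR 2 * 2)%R; last by ring.
by rewrite ler_wpM2l ?mulr_ge0 ?expR_ge0// geometric_half_le.
Qed.

Lemma ae_pairing_bump_bounded (P : probability (Gamma R) R) :
  is_poisson_measure (lebesgueC R) P ->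
  {ae P, forall gamma : Gamma R, exists B : R, forall n, (pairing (bump n) gamma <= B)%R}.
Proof.
move=> PP; pose h n (gamma : Gamma R) := (expR (pairing (bump n) gamma))%:E.
have mh n : measurable_fun [set: Gamma R] (h n).
  apply/measurable_EFinP; apply: (measurableT_comp (@measurable_expR R)).
  by apply: measurable_pairing; exact: bump_C0.
have h0 n gamma : 0 <= h n gamma by rewrite lee_fin expR_ge0.
have hh gamma : {homo h ^~ gamma : m n / (m <= n)%N >-> m <= n}.
  by move=> m n mn; rewrite lee_fin ler_expR pairing_bump_le.
have hcvg gamma : cvgn (h ^~ gamma) by exact: ereal_nondecreasing_is_cvgn.
have hint n : \int[P]_gamma h n gamma <= (expR (32 * expR 2))%:E.
  rewrite PP; last exact: bump_C0.
  by rewrite -[leRHS]/(expeR (32 * expR 2)%:E) lee_expeR integral_expR_bump_le.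
(* Taken in the extended reals, where the increasing sequence always converges; integrability then
   makes the limit finite almost everywhere. *)
have lim_int : P.-integrable [set: Gamma R] (fun gamma => limn (h ^~ gamma)).
  apply/integrableP; split.
    by apply: emeasurable_fun_cvg => [|gamma _]; [exact: mh|exact: hcvg].
  under eq_integral => gamma _.
    rewrite gee0_abs; last by apply: lime_ge => //; apply: nearW => n; exact: h0.
    over.
  rewrite monotone_convergence//.
  apply: (@le_lt_trans _ _ (expR (32 * expR 2))%:E); last exact: ltry.
  apply: lime_le; last by apply: nearW => n; exact: hint.
  apply: ereal_nondecreasing_is_cvgn => m n mn.
  by apply: ge0_le_integral => // gamma _; exact: hh.
have := integrable_ae measurableT lim_int.
apply: filterS => gamma /(_ I) limfin.
exists (fine (limn (h ^~ gamma))) => n.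
have : h n gamma <= limn (h ^~ gamma).
  rewrite (cvg_lim _ (ereal_nondecreasing_cvgn (hh gamma)))//.
  by apply: ereal_sup_ubound; exists n.
(* By x <= 1 + x <= exp(x), the finite limit of the exponentials also bounds the pairings. *)
rewrite -(fineK limfin) lee_fin; apply: le_trans.
by rewrite (le_trans _ (expR_ge1Dx _))// lerDr.
Qed.

End ExponentialMoments.

(** * Inverse powers summed over one configuration, and the conclusion *)

Section Configurations.
Variable R : realType.
Implicit Types gamma : configuration R.

Lemma countable_points gamma : countable (points gamma).
Proof.
have -> : points gamma = \bigcup_n (points gamma `&` square n%:R).
  rewrite -setI_bigcupr; apply/esym/setIidl => z _.
  exists (Num.trunc (cnorm z)).+1 => //; apply: cnorm_square.
  exact/ltW/truncnS_gt.
by apply: bigcup_countable => // n _; apply/finite_set_countable/points_square.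
Qed.

Lemma points_inv_bounded gamma :
  exists r : R, forall x, (points gamma `\ 0) x -> cnorm x^-1 <= r.
Proof.
pose t := finmap.enum_fset (fset_set (points gamma `&` square 1)).
(* Points of modulus above 1 are covered by the 1, and the finitely many others by the sum. The
   origin may occur in [t] and adds only 0, its inverse being 0 by convention. *)
exists (1 + \sum_(x <- t) cnorm x^-1) => x [gx _].
have s0 (s : seq R[i]) : 0 <= \sum_(x <- s) cnorm x^-1.
  by apply: sumr_ge0 => y _; exact: cnorm_ge0.
have [x1|/ltW x1] := leP (cnorm x) 1; last first.
  rewrite cnormV; apply: (@le_trans _ _ 1); last by rewrite lerDl.
  by rewrite invf_le1// (lt_le_trans ltr01).
rewrite (big_rem x)/=; last first.
  by rewrite /t in_fset_set ?inE; [split=> //; exact: cnorm_square|exact: points_square].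
by rewrite addrCA lerDl addr_ge0.
Qed.

(** Since p + 1 >= 3, the excess power p - 2 is absorbed by the bound on 1/x. One index [N] serves
    all entries of the finite list, so their cubes are controlled by a single pairing. The absolute
    value covers a negative [r], possible when there are no nonzero points. *)
Lemma sum_inv_le gamma (r B : R) (p : nat) : (2 <= p)%N ->
  (forall x, (points gamma `\ 0) x -> cnorm x^-1 <= r) ->
  (forall n, pairing (bump n) gamma <= B) ->
  forall s, uniq s -> seq_in (points gamma `\ 0) s ->
  \sum_(x <- s) cnorm x^-1 ^+ p.+1 <= `|r| ^+ (p - 2) * ((8 + `|r| ^+ 3) * B).
Proof.
move=> p2 gr gB s us sg.
have [N sN] : exists N, forall n, (N <= n)%N ->
    forall x, x \in s -> cnorm x^-1 ^+ 3 <= (8 + `|r| ^+ 3) * bump n x.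
  elim: s sg {us} => [|y s IH] sg; first by exists 0%N.
  have [|N NP] := IH; first by move=> x xs; apply: sg; rewrite in_cons xs orbT.
  have yg : (points gamma `\ 0) y by apply: sg; rewrite mem_head.
  have y0 : y != 0 by apply/eqP => y0; apply: yg.2.
  have [M MP] := inv_cube_le_bump y0 (le_trans (gr _ yg) (ler_norm r)).
  exists (maxn N M) => n; rewrite geq_max => /andP[Nn Mn] x.
  by rewrite in_cons => /predU1P[->|]; [exact: MP|exact: NP].
have sB : \sum_(x <- s) bump N x <= B.
  apply: le_trans (gB N); apply: (pairing_ge_sum (@bump_support R N) (bump_ge0 N)) => //.
  by move=> x /sg[].
apply: (@le_trans _ _ (`|r| ^+ (p - 2) * ((8 + `|r| ^+ 3) * \sum_(x <- s) bump N x))).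
  rewrite !mulr_sumr big_seq [leRHS]big_seq; apply: ler_sum => x xs.
  rewrite -[p.+1](subnK (_ : 3 <= p.+1)%N)// exprD subSS.
  rewrite ler_pM ?exprn_ge0 ?cnorm_ge0 ?sN// lerXn2r ?nnegrE ?cnorm_ge0//.
  exact: le_trans (gr _ (sg _ xs)) (ler_norm r).
by rewrite ler_wpM2l ?exprn_ge0// ler_wpM2l// addr_ge0 ?exprn_ge0.
Qed.

End Configurations.

Theorem theorem2p3 (R : realType) (pi_m : probability (Gamma R) R)
    (pi_mP : is_poisson_measure (lebesgueC R) pi_m) (p : nat) (hp : (2 <= p)%N) :
  {ae pi_m, forall gamma : Gamma R,
    (forall z : R[i]%C, Pi_converges p z gamma) /\
    entire (fun z : R[i]%C => Pi p z gamma)}.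
Proof.
apply: filterS (ae_pairing_bump_bounded pi_mP) => gamma [B gB].
have [r gr] := points_inv_bounded gamma.
apply: (@weierstrass_criterion _ _ p r) => //.
  by apply: sub_countable (countable_points gamma); apply: subset_card_le => x [].
exact: sum_inv_le hp gr gB.
Qed.
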